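(* Let $T:E\to X$ be a continuous linear operator from an $AM$-space $E$ to a Banach space $X$. Then the following assertions (1)-(6) are equivalent: (1) $T$ is $M$-weakly compact. (2) $T$ is weakly compact. (3) $T$ is Dunford-Pettis. (4) $T$ is $wun$-Dunford-Pettis. (5) $T$ is $uaw$-Dunford-Pettis. (6) $T$ is $b$-weakly compact. Moreover, if $E$ has property $(b)$, then these assertions are also equivalent to: (7) $T$ is order weakly compact.
   Context: Let $E$ be a Banach lattice, $X$ a Banach space and $T:E\to X$ a continuous operator. A net $(x_\alpha)$ in $E$ is $un$-convergent to $x$ if $\| |x_\alpha - x| \wedge u \| \to 0$ for every $u \in E^+$. It is $uaw$-convergent to $x$ if $|x_\alpha-x|\wedge u\to 0$ weakly for every $u\in E^+$. A linear functional $f:E\to\mathbb{R}$ is $un$-continuous if $f(x_\alpha)\to 0$ for every norm bounded net $(x_\alpha)\subseteq E$ that is $un$-convergent to $0$. $E^{\diamond}\subseteq E^*$ denotes the vector space of all $un$-continuous functionals on $E$. The $wun$-topology on $E$ is the smallest topology for which every $f\in E^{\diamond}$ is continuous, and $\xrightarrow{wun}$ is convergence in it. The operator $T$ is: - Dunford-Pettis if $x_n\to 0$ weakly in $E$ implies $\|Tx_n\|\to 0$; - $wun$-Dunford-Pettis if for every norm bounded sequence $(x_n)\subseteq E$, $x_n\xrightarrow{wun}0$ implies $\|Tx_n\|\to 0$; - $uaw$-Dunford-Pettis if for every norm bounded sequence $(x_n)\subseteq E$ that is $uaw$-convergent to $0$, $\|Tx_n\|\to 0$; - weakly compact if $T$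 maps the closed unit ball to a relatively weakly compact set; - $M$-weakly compact if $\|Tx_n\|\to 0$ for every norm bounded disjoint sequence $(x_n)$ in $E$; - order weakly compact if $T[0,x]$ is relatively weakly compact for each $x\in E^+$; - $b$-weakly compact if $T(A)$ is relatively weakly compact for each $b$-order bounded subset $A$ of $E$. Here $E^\sim$ is the order dual of $E$ and $(E^\sim)^\sim$ its order bidual. A subset $A\subseteq E$ is $b$-order bounded if it is order bounded in $(E^\sim)^\sim$ (under the canonical embedding). $E$ has property $(b)$ if every $b$-order bounded subset of $E$ is order bounded in $E$. *)

(* Defs.v *)
From HB Require Import structures.
From mathcomp Require Import all_boot all_order all_algebra.
From mathcomp Require Import all_classical all_reals all_analysis.

Set Implicit Arguments.
Unset Strict Implicit.
Unset Printing Implicit Defensive.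

Import Order.TTheory GRing.Theory Num.Theory.
Import numFieldNormedType.Exports.

Local Open Scope classical_set_scope.
Local Open Scope ring_scope.

(* The order is a field of the mixin rather than an inherited latticeType:
   Hierarchy Builder has no join of Order.Lattice and NormedModule. The lattice
   structure of the library is recovered on every banachLatticeType below. *)
HB.mixin Record CompleteNormedModule_isBanachLattice (R : realType) E
    of CompleteNormedModule R E := {
  bl_le : rel E ;
  bl_meet : E -> E -> E ;
  bl_join : E -> E -> E ;
  bl_lexx : reflexive bl_le ;
  bl_le_anti : antisymmetric bl_le ;
  bl_le_trans : transitive bl_le ;
  bl_lexI : forall x y z, bl_le x (bl_meet y z) = bl_le x y && bl_le x z ;
  bl_leUx : forall x y z, bl_le (bl_join x y) z = bl_le x z && bl_le y z ;
  bl_leD2r : forall z x y : E, bl_le x y -> bl_le (x + z) (y + z) ;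
  bl_scaler_ge0 : forall (a : R) (x : E),
    0 <= a -> bl_le 0 x -> bl_le 0 (a *: x) ;
  bl_ler_norm : forall x y : E,
    bl_le (bl_join x (- x)) (bl_join y (- y)) -> `|x| <= `|y|
}.

#[short(type="banachLatticeType")]
HB.structure Definition BanachLattice (R : realType) :=
  {E of CompleteNormedModule R E & CompleteNormedModule_isBanachLattice R E}.

HB.instance Definition _ (R : realType) (E : banachLatticeType R) :=
  Order.Le_isPOrder.Build ring_display (BanachLattice.sort E)
    (@bl_lexx R E) (@bl_le_anti R E) (@bl_le_trans R E).
HB.instance Definition _ (R : realType) (E : banachLatticeType R) :=
  Order.POrder_isMeetSemilattice.Build ring_display (BanachLattice.sort E)
    (@bl_lexI R E).
HB.instance Definition _ (R : realType) (E : banachLatticeType R) :=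
  Order.POrder_isJoinSemilattice.Build ring_display (BanachLattice.sort E)
    (@bl_leUx R E).

(* |x| = x \/ -x; the notation `|x| denotes the norm of x. *)
Definition labs (R : realType) (E : banachLatticeType R) (x : E) : E :=
  Order.join x (- x).

Definition AM_space (R : realType) (E : banachLatticeType R) : Prop :=
  forall x y : E, 0 <= x -> 0 <= y ->
    `|Order.join x y| = Num.max `|x| `|y|.

(* The smallest topology on V making every f in S continuous. *)
Section functional_topology.
Context {R : realType} {V : choiceType}.

Definition functional_topology (S : set (V -> R)) : Type := V.

Variable S : set (V -> R).

HB.instance Definition _ := Topological.copy (functional_topology S)
  (sup_topology (fun f : {f : V -> R | S f} =>
     Topological.class (initial_topology (sval f)))).

End functional_topology.

Definition topological_dual (R : realType) (V : normedModType R) :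
    set (V -> R) :=
  [set f : V -> R | scalar f /\ continuous f].

Definition weak (R : realType) (V : normedModType R) : topologicalType :=
  functional_topology (@topological_dual R V).

Definition relatively_weakly_compact (R : realType) (V : normedModType R)
    (A : set V) : Prop :=
  @precompact (weak V) A.

(* A net is a function on a directed preordered type (I, le); its convergence is
   convergence along the filter of tails. *)
Definition directed (I : Type) (le : I -> I -> Prop) : Prop :=
  [/\ inhabited I, (forall i, le i i),
      (forall i j k, le i j -> le j k -> le i k)
    & (forall i j, exists k, le i k /\ le j k)].

Definition tails (I : Type) (le : I -> I -> Prop) : set_system I :=
  filter_from [set: I] (fun i => [set j | le i j]).

Section unbounded_convergence.
Context {R : realType} {E : banachLatticeType R}.

(* The filter F is [tails le] for nets and \oo for sequences. *)
Definition un_cvg (I : Type) (F : set_system I) (x : I -> E) (l : E) : Prop :=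
  forall u : E, 0 <= u ->
    `|Order.meet (labs (x i - l)) u| @[i --> F] --> (0 : R).

Definition uaw_cvg (I : Type) (F : set_system I) (x : I -> E) (l : E) : Prop :=
  forall u : E, 0 <= u ->
    Order.meet (labs (x i - l)) u @[i --> F] --> ((0 : E) : weak E).

Definition un_continuous (f : E -> R) : Prop :=
  forall (I : Type) (le : I -> I -> Prop) (x : I -> E), directed le ->
    bounded_fun x -> un_cvg (tails le) x 0 ->
    f (x i) @[i --> tails le] --> (0 : R).

End unbounded_convergence.

Definition un_dual (R : realType) (E : banachLatticeType R) : set (E -> R) :=
  [set f : E -> R | scalar f /\ un_continuous f].

Definition wun (R : realType) (E : banachLatticeType R) : topologicalType :=
  functional_topology (@un_dual R E).

(* The order dual of a vector space V preordered by le, ordered by its positive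
   cone. Applying it twice to a Banach lattice gives the order bidual. *)
Section order_dual.
Context {R : realType} {V : lmodType R}.

Definition order_bounded (le : rel V) (A : set V) : Prop :=
  exists a b : V, forall x, A x -> le a x && le x b.

Variable le : rel V.

Definition order_dual_pred : {pred V -> R^o} := fun f =>
  `[< scalar f /\
      forall A, order_bounded le A -> bounded_set (f @` A) >].

Record order_dual := OrderDual {
  order_dual_val :> V -> R^o ;
  _ : order_dual_val \in order_dual_pred }.

HB.instance Definition _ := [isSub for order_dual_val].
HB.instance Definition _ := [Choice of order_dual by <:].

Lemma order_dual_submod_closed : submod_closed order_dual_pred.
Proof.
split.
  apply/asboolP; split; first by move=> a x y; rewrite /= mulr0 addr0.
  move=> A _; exists 0; split=> // M M0 _ [x _ <-].
  by rewrite /= normr0 ltW.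
move=> a f g /asboolP[lf bf] /asboolP[lg bg]; apply/asboolP; split.
  move=> b x y; rewrite /= !fctE lf lg.
  by rewrite /GRing.scale/= /GRing.scale/= !mulrDr !mulrA (mulrC a b) addrACA.
move=> A Abd; have [Mf [_ bfA]] := bf A Abd; have [Mg [_ bgA]] := bg A Abd.
exists (`|a| * (`|Mf| + 1) + (`|Mg| + 1)); split; first exact: num_real.
move=> M ltM _ [x Ax <-]; apply: le_trans (ltW ltM).
apply: le_trans (ler_normD _ _) _; apply: lerD.
  rewrite normrM ler_wpM2l //; apply: bfA; last by exists x.
  by rewrite (le_lt_trans (ler_norm _)) // ltrDl.
apply: bgA; last by exists x.
by rewrite (le_lt_trans (ler_norm _)) // ltrDl.
Qed.

HB.instance Definition _ := GRing.isSubmodClosed.Build _ _ order_dual_pred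
  order_dual_submod_closed.
HB.instance Definition _ := [SubChoice_isSubLmodule of order_dual by <:].

Definition order_dual_le : rel order_dual := fun f g =>
  `[< forall x : V, le 0 x -> f x <= g x >].

End order_dual.

Section order_bidual.
Context {R : realType} {E : banachLatticeType R}.

Local Notation Edual := (order_dual (<=%R : rel E)).
Local Notation Ebidual := (order_dual (@order_dual_le _ _ (<=%R : rel E))).

Lemma order_bidual_eval_subproof (x : E) :
  (fun f : Edual => f x) \in
    order_dual_pred (@order_dual_le _ _ (<=%R : rel E)).
Proof.
apply/asboolP; split.
  by move=> a f g.
move=> A [g [h ghA]].
have x0 : 0 <= Order.join x 0 :> E by exact: leUr.
have y0 : 0 <= Order.join x 0 - x :> E.
  by have := bl_leD2r (- x) _ _ (leUl x (0 : E)); rewrite subrr.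
have fE (f : Edual) : f x = f (Order.join x 0) - f (Order.join x 0 - x).
  have lf : scalar (f : E -> R) by have /asboolP[] := valP f.
  have fB u v : f (u - v) = f u - f v.
    by rewrite -scaleN1r addrC lf mulN1r addrC.
  by rewrite -fB opprB addrC subrK.
exists (`|g (Order.join x 0)| + `|h (Order.join x 0)|
  + (`|g (Order.join x 0 - x)| + `|h (Order.join x 0 - x)|)).
split; first exact: num_real.
move=> M ltM _ [f Af <-]; apply: le_trans (ltW ltM).
have /andP[/asboolP gf /asboolP fh] := ghA _ Af.
have bnd y : 0 <= y -> `|f y| <= `|g y| + `|h y|.
  move=> y_ge0; have gfy := gf _ y_ge0; have fhy := fh _ y_ge0.
  rewrite ler_norml; apply/andP; split.
    rewrite lerNl; apply: (@le_trans _ _ `|g y|); last by rewrite lerDl.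
    by rewrite -normrN; apply: le_trans (ler_norm _); rewrite lerN2.
  apply: (@le_trans _ _ `|h y|); last by rewrite lerDr.
  exact: le_trans fhy (ler_norm _).
rewrite /= fE; apply: le_trans (ler_normB _ _) _.
by apply: lerD; exact: bnd.
Qed.

Definition order_bidual_eval (x : E) : Ebidual :=
  OrderDual (order_bidual_eval_subproof x).

Definition b_order_bounded (A : set E) : Prop :=
  order_bounded (@order_dual_le _ _ (@order_dual_le _ _ (<=%R : rel E)))
    (order_bidual_eval @` A).

End order_bidual.

Definition property_b (R : realType) (E : banachLatticeType R) : Prop :=
  forall A : set E, b_order_bounded A -> order_bounded (<=%R : rel E) A.

Section operators.
Context {R : realType} {E : banachLatticeType R} {X : completeNormedModType R}.
Variable T : {linear E -> X}.

Definition Dunford_Pettis : Prop := forall x : nat -> E,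
  x @ \oo --> ((0 : E) : weak E) -> `|T (x n)| @[n --> \oo] --> (0 : R).

Definition wun_Dunford_Pettis : Prop := forall x : nat -> E, bounded_fun x ->
  x @ \oo --> ((0 : E) : wun E) -> `|T (x n)| @[n --> \oo] --> (0 : R).

Definition uaw_Dunford_Pettis : Prop := forall x : nat -> E, bounded_fun x ->
  uaw_cvg \oo x 0 -> `|T (x n)| @[n --> \oo] --> (0 : R).

Definition weakly_compact : Prop :=
  relatively_weakly_compact (T @` [set x | `|x| <= 1]).

Definition M_weakly_compact : Prop := forall x : nat -> E, bounded_fun x ->
  (forall n m, n != m -> Order.meet (labs (x n)) (labs (x m)) = 0) ->
  `|T (x n)| @[n --> \oo] --> (0 : R).

Definition order_weakly_compact : Prop := forall x : E, 0 <= x ->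
  relatively_weakly_compact (T @` [set y | 0 <= y <= x]).

Definition b_weakly_compact : Prop := forall A : set E, b_order_bounded A ->
  relatively_weakly_compact (T @` A).

End operators.

(* Main.v *)
(* In an AM-space every functional f is almost carried by a norm bounded order
   interval: if f >= 0 and f u > |f| - e with u in the positive unit ball, then
   f (|x| - u)^+ <= e on the unit ball, because the join of |x| and u stays in the
   ball. Hence bounded un-, uaw- and wun-null sequences are weakly null, and since
   norm bounded disjoint sequences are null in all these senses, (3) => (4), (5) =>
   (1). The positive unit ball is directed upwards, and the limit of f x along it
   is an element of the order bidual dominating the ball; so the ball is b-order
   bounded, which links (2) with (6) and (7).

   (1) => (2), (3). Let q v = sup {|T z| : |z| <= v}. For a chain
   p_0 <= r_0 <= p_1 <= r_1 <= ... in [0, w] and a fixed level t w, the elements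
   (t w - p_n)^+ meet (r_n - t w)^+ are disjoint, and summing over a grid of levels
   dominates r_n - p_n up to a small multiple of w; therefore q (r_n - p_n) -> 0.
   This gives a positive functional mu controlling T: |T v| <= d whenever
   |v| <= 1 and mu |v| <= 1. For (3), weakly null x_n have mu |x_n| -> 0. For (2),
   x |-> sum_t mu |x - t w| over the same grid is almost strictly convex, so near
   minimisers of it over the convex hulls of the members of an ultrafilter
   approximate the weak limit of the ultrafilter in norm.

   (2) => (1). If |T x_n| > e for a bounded disjoint sequence, the partial sums of
   a subsequence are separated in the manner of James's criterion by norming
   functionals of the T x_n. *)

Require Import Defs.
From mathcomp Require Import all_boot all_order all_algebra.
From mathcomp Require Import all_classical all_reals all_analysis.
From mathcomp Require Import lra ring.

Set Implicit Arguments.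
Unset Strict Implicit.
Unset Printing Implicit Defensive.

Import Order.TTheory GRing.Theory Num.Theory.
Import numFieldNormedType.Exports.

Local Open Scope classical_set_scope.
Local Open Scope ring_scope.

(** The model is a space of continuous functions, but no representation of [E] is used and no order
    unit is assumed. Pointwise arguments become lattice inequalities: a grid of levels stands for
    the values of a function, and near-maximal elements of the ball stand for the unit. The
    functional [mu] is an analogue of a control measure. M-weak compactness makes the moduli of the
    [h] composed with [T], [h] in the dual ball, uniformly small along disjoint sequences, and, as
    for families of measures, a single functional then governs them all. The obstacle in (1) => (2)
    is that an ultrafilter on the ball of [E] need not converge weakly in [E], so the limit has to
    be built in [X]. The convex potential does here what uniform convexity of an L2-norm does
    elsewhere: near minimisers are close to each other for [mu], hence have close images. In (2) =>
    (1) the AM hypothesis serves to keep the partial sums of a bounded disjoint sequence bounded. *)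

Local Notation "x \join y" := (Order.join x y) (at level 45, left associativity).
Local Notation "x \meet y" := (Order.meet x y) (at level 45, left associativity).

(** * Vector lattices *)

Section vector_lattice.
Context {R : realType} {E : banachLatticeType R}.
Implicit Types (x y z u v w a b c m g e p r t : E) (k : R) (n : nat).

Definition lpos x : E := x \join 0.

Lemma le_add2r z x y : (x + z <= y + z) = (x <= y).
Proof.
apply/idP/idP => [h|h]; last exact: bl_leD2r.
by rewrite -(addrK z x) -(addrK z y); exact: bl_leD2r.
Qed.

Lemma le_add2l z x y : (z + x <= z + y) = (x <= y).
Proof. by rewrite ![z + _]addrC le_add2r. Qed.

Lemma le_add x y z u : x <= y -> z <= u -> x + z <= y + u.
Proof.
move=> xy zu; apply: (@le_trans _ _ (y + z)); first by rewrite le_add2r.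
by rewrite le_add2l.
Qed.

Lemma le_sub0 x y : (0 <= y - x) = (x <= y).
Proof. by rewrite -(le_add2r x 0) add0r subrK. Qed.

Lemma le_subr x y z : (x - y <= z) = (x <= z + y).
Proof. by rewrite -(le_add2r y (x - y)) subrK. Qed.

Lemma le_subl x y z : (x <= y - z) = (x + z <= y).
Proof. by rewrite -(le_add2r z x) subrK. Qed.

Lemma le_oppr2 x y : (- x <= - y) = (y <= x).
Proof. by rewrite -(le_add2r (x + y) (- x)) addKr addrCA addNr addr0. Qed.

Lemma le_oppl x y : (- x <= y) = (- y <= x).
Proof. by rewrite -le_oppr2 opprK. Qed.

Lemma le_oppr0 x : (- x <= 0) = (0 <= x).
Proof. by rewrite -le_oppr2 opprK oppr0. Qed.

Lemma le_add0 x y : 0 <= x -> 0 <= y -> 0 <= x + y.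
Proof. by move=> x0 y0; rewrite -(addr0 0); exact: le_add. Qed.

Lemma le_sum0 (I : Type) (r : seq I) (P : pred I) (x : I -> E) :
  (forall i, P i -> 0 <= x i) -> 0 <= \sum_(i <- r | P i) x i.
Proof. by move=> x0; apply: (big_ind (fun z : E => 0 <= z)) => // y z; exact: le_add0. Qed.

Lemma le_addr x y : 0 <= y -> x <= x + y.
Proof. by move=> y0; rewrite -{1}(addr0 x) le_add2l. Qed.

Lemma le_addl x y : 0 <= y -> x <= y + x.
Proof. by move=> y0; rewrite addrC le_addr. Qed.

Lemma scale_ge0 k x : 0 <= k -> 0 <= x -> 0 <= k *: x.
Proof. exact: bl_scaler_ge0. Qed.

Lemma le_scale k x y : 0 <= k -> x <= y -> k *: x <= k *: y.
Proof. by move=> k0 xy; rewrite -le_sub0 -scalerBr scale_ge0// le_sub0. Qed.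

Lemma le_scale_pos k x y : 0 < k -> (k *: x <= k *: y) = (x <= y).
Proof.
move=> k0; apply/idP/idP; last exact/le_scale/ltW.
move=> /(@le_scale k^-1); rewrite invr_ge0 (ltW k0) => /(_ isT).
by rewrite !scalerA mulVf ?gt_eqF// !scale1r.
Qed.

Lemma le_scalel k l x : k <= l -> 0 <= x -> k *: x <= l *: x.
Proof. by move=> kl x0; rewrite -le_sub0 -scalerBl scale_ge0// subr_ge0. Qed.

Lemma joinDr x y z : (x \join y) + z = (x + z) \join (y + z).
Proof.
apply/le_anti/andP; split; last by rewrite leUx !le_add2r leUl leUr.
by rewrite -le_subl leUx !le_subl leUl leUr.
Qed.

Lemma joinDl x y z : z + (x \join y) = (z + x) \join (z + y).
Proof. by rewrite addrC joinDr ![_ + z]addrC. Qed.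

Lemma oppJ x y : - (x \join y) = (- x) \meet (- y).
Proof.
apply/le_anti/andP; split; first by rewrite lexI !le_oppr2 leUl leUr.
by rewrite -le_oppr2 opprK leUx -le_oppr2 opprK leIl/= -le_oppr2 opprK leIr.
Qed.

Lemma oppM x y : - (x \meet y) = (- x) \join (- y).
Proof. by rewrite -[RHS]opprK oppJ !opprK. Qed.

Lemma meetDr x y z : (x \meet y) + z = (x + z) \meet (y + z).
Proof.
apply/le_anti/andP; split; first by rewrite lexI !le_add2r leIl leIr.
by rewrite -le_subr lexI !le_subr leIl leIr.
Qed.

Lemma meetDl x y z : z + (x \meet y) = (z + x) \meet (z + y).
Proof. by rewrite addrC meetDr ![_ + z]addrC. Qed.

Lemma joinZ k x y : 0 < k -> k *: (x \join y) = (k *: x) \join (k *: y).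
Proof.
move=> k0; apply/le_anti/andP; split; last first.
  by rewrite leUx !le_scale_pos// leUl leUr.
rewrite -(le_scale_pos (k := k^-1)) ?invr_gt0// scalerA mulVf ?gt_eqF// scale1r.
have kK z : z = k^-1 *: (k *: z) by rewrite scalerA mulVf ?gt_eqF// scale1r.
have k'0 : 0 < k^-1 by rewrite invr_gt0.
by rewrite leUx {1}[x]kK {2}[y]kK !(le_scale_pos _ _ k'0) leUl leUr.
Qed.

Lemma meetZ k x y : 0 < k -> k *: (x \meet y) = (k *: x) \meet (k *: y).
Proof.
by move=> k0; rewrite -[LHS]opprK -scalerN oppM joinZ// oppJ !scalerN !opprK.
Qed.

Lemma joinD_meet x y : x \join y + x \meet y = x + y.
Proof.
have -> : x \meet y = x + y - x \join y.
  by rewrite oppJ meetDl addrK addrAC subrr add0r meetC.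
by rewrite addrC subrK.
Qed.

(** Distributivity comes from the group structure: by [joinD_meet], a bound on [x \meet t] turns
    into one on [t], and the bounds on [y] and [z] combine into one on their join. *)
Lemma meet_join_le x y z : x \meet (y \join z) <= (x \meet y) \join (x \meet z).
Proof.
set v := (x \meet y) \join (x \meet z); set s := y \join z.
have h t : x \meet t <= v -> t <= s -> t <= (x \join s) + v - x.
  move=> tv ts; rewrite le_subl addrC -(joinD_meet x t); apply: le_add => //.
  by rewrite leUx leUl lexUr.
have : s <= (x \join s) + v - x.
  by rewrite {1}/s leUx !h ?leUl ?leUr.
by rewrite le_subl addrC -(joinD_meet x s) le_add2l.
Qed.

Lemma labs_ge x : x <= labs x. Proof. exact: leUl. Qed.
Lemma labs_geN x : - x <= labs x. Proof. exact: leUr. Qed.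

Lemma labs_le x u : (labs x <= u) = (x <= u) && (- x <= u).
Proof. exact: leUx. Qed.

Lemma half_ge0 x : 0 <= x + x -> 0 <= x.
Proof.
move=> h; have := @scale_ge0 2^-1 _ _ h; rewrite invr_ge0 ler0n => /(_ isT).
by rewrite scalerDr -scalerDl -[2^-1]mul1r -splitr scale1r.
Qed.

Lemma labs_ge0 x : 0 <= labs x.
Proof.
by apply: half_ge0; rewrite -(subrr x); exact: le_add (labs_ge x) (labs_geN x).
Qed.

Lemma labsN x : labs (- x) = labs x.
Proof. by rewrite /labs opprK joinC. Qed.

Lemma labs_pos x : 0 <= x -> labs x = x.
Proof.
move=> x0; apply/le_anti; rewrite labs_ge labs_le lexx/= andbT.
by apply: (le_trans _ x0); rewrite le_oppr0.
Qed.

Lemma labs_id x : labs (labs x) = labs x.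
Proof. exact/labs_pos/labs_ge0. Qed.

Lemma labs0 : labs (0 : E) = 0.
Proof. exact: labs_pos. Qed.

Lemma labsD x y : labs (x + y) <= labs x + labs y.
Proof.
by rewrite labs_le opprD !le_add// ?labs_ge ?labs_geN.
Qed.

Lemma labsZ k x : labs (k *: x) = `|k| *: labs x.
Proof.
have h l : 0 < l -> labs (l *: x) = l *: labs x.
  by move=> l0; rewrite /labs -scalerN joinZ.
case: (ltrgt0P k) => [k0|k0|->]; last by rewrite !scale0r labs0.
  exact: h.
by rewrite -labsN -scaleNr h// oppr_gt0.
Qed.

Lemma norm_le x y : labs x <= labs y -> `|x| <= `|y|.
Proof. exact: bl_ler_norm. Qed.

Lemma norm_le_pos x y : labs x <= y -> `|x| <= `|y|.
Proof. by move=> xy; apply/norm_le/(le_trans xy)/labs_ge. Qed.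

Lemma norm_labs x : `|labs x| = `|x|.
Proof. by apply/le_anti; rewrite !norm_le// labs_id. Qed.

Lemma norm_le0 x y : 0 <= x -> x <= y -> `|x| <= `|y|.
Proof. by move=> x0 xy; apply: norm_le_pos; rewrite labs_pos. Qed.

Lemma lpos_ge0 x : 0 <= lpos x. Proof. exact: leUr. Qed.
Lemma lpos_ge x : x <= lpos x. Proof. exact: leUl. Qed.
Lemma lpos_le x u : (lpos x <= u) = (x <= u) && (0 <= u).
Proof. exact: leUx. Qed.
Lemma lpos_mono x y : x <= y -> lpos x <= lpos y.
Proof. by move=> xy; rewrite lpos_le lpos_ge0 (le_trans xy (lpos_ge y)). Qed.
Lemma lpos_pos x : 0 <= x -> lpos x = x.
Proof. by move=> x0; apply/le_anti; rewrite lpos_ge lpos_le lexx x0. Qed.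

Lemma lposN_meet x : lpos (- x) = - (x \meet 0).
Proof. by rewrite oppM oppr0. Qed.

Lemma lposB x : lpos x - lpos (- x) = x.
Proof. by rewrite lposN_meet opprK joinD_meet addr0. Qed.

Lemma lposD x : lpos x + lpos (- x) = labs x.
Proof.
have -> : lpos (- x) = lpos x - x by rewrite -{3}(lposB x) opprB addrC subrK.
rewrite addrA -[lpos x](scale1r (lpos x)) -scalerDl joinZ// scaler0 joinDr add0r.
by rewrite scalerDl scale1r addrK.
Qed.

Lemma lpos_disj x : lpos x \meet lpos (- x) = 0.
Proof.
rewrite -[lpos x](subrK (lpos (- x))) lposB -{2}[lpos (- x)]add0r -meetDr.
by rewrite lposN_meet subrr.
Qed.

Lemma lpos_labs x : lpos x <= labs x.
Proof. by rewrite lpos_le labs_ge labs_ge0. Qed.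

Lemma norm_lpos x : `|lpos x| <= `|x|.
Proof. by apply: norm_le; rewrite labs_pos ?lpos_ge0// lpos_labs. Qed.

Lemma lposD_le x y : lpos (x + y) <= lpos x + lpos y.
Proof. by rewrite lpos_le le_add0 ?lpos_ge0// le_add ?lpos_ge. Qed.

Lemma lposZ k x : 0 <= k -> lpos (k *: x) = k *: lpos x.
Proof.
rewrite le_eqVlt => /predU1P[<-|k0]; first by rewrite !scale0r lpos_pos.
by rewrite /lpos joinZ// scaler0.
Qed.

Lemma meet_mono x y z u : x <= y -> z <= u -> x \meet z <= y \meet u.
Proof. by move=> xy zu; rewrite lexI !leIx2// ?xy ?zu ?orbT. Qed.

Lemma meet_ge0 x y : 0 <= x -> 0 <= y -> 0 <= x \meet y.
Proof. by move=> x0 y0; rewrite lexI x0. Qed.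

Lemma meetD_le x y z : 0 <= x -> 0 <= y -> 0 <= z ->
  (x + y) \meet z <= x \meet z + y \meet z.
Proof.
move=> x0 y0 z0; rewrite meetDr lexI; apply/andP; split.
  rewrite meetDl lexI leIl/=; apply: (le_trans (leIr _ _)).
  exact: le_addl.
by apply: (le_trans (leIr _ _)); rewrite le_addr// meet_ge0.
Qed.

Lemma meet_disj_le x y u v : 0 <= u -> 0 <= v -> u <= x -> v <= y ->
  x \meet y = 0 -> u \meet v = 0.
Proof.
move=> u0 v0 ux vy xy; apply/le_anti; rewrite meet_ge0// andbT -xy.
exact: meet_mono.
Qed.

Lemma meet_scale_le k x y : 0 <= x -> 0 <= y -> 0 <= k ->
  x \meet y = 0 -> (k *: x) \meet y = 0.
Proof.
(* [k + 1] dominates both [k] and [1], so the meet lies below [l *: (x \meet y)]. *)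
move=> x0 y0 k0 xy; set l := k + 1.
have l0 : 0 < l by rewrite /l ltr_wpDl.
apply: (@meet_disj_le (l *: x) (l *: y)) => //; first exact: scale_ge0.
- by rewrite le_scalel// /l lerDl.
- by rewrite -{1}(scale1r y) le_scalel// /l lerDr.
- by rewrite -meetZ// xy scaler0.
Qed.

Lemma riesz_decomp a b z : 0 <= a -> 0 <= b -> labs z <= a + b ->
  exists z1 z2 : E, [/\ z = z1 + z2, labs z1 <= a & labs z2 <= b].
Proof.
move=> a0 b0; rewrite labs_le => /andP[zab Nzab].
have aa : - a <= a by apply: (@le_trans _ _ 0); rewrite ?le_oppr0.
(* [z] truncated to the interval from [- a] to [a], and the remainder. *)
exists ((z \meet a) \join - a), (z - (z \meet a) \join - a); split.
- by rewrite addrC subrK.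
- rewrite labs_le leUx leIr aa/= oppJ opprK.
  exact: leIr.
rewrite labs_le opprB oppJ opprK oppM meetDl joinDl subrr; apply/andP; split.
  apply: (le_trans (leIl _ _)); rewrite leUx b0/= le_subr addrC.
  exact: zab.
rewrite le_subr leUx; apply/andP; split.
  by apply: (le_trans (leIl _ _)); exact: le_addl.
by rewrite le_oppl opprD addrC le_subr.
Qed.

(** Distributing the meet leaves pieces below [a] or [b], except [- a \meet - b], which is
    [- (a \join b)]. *)
Lemma labs_join_ge a b : labs a \meet labs b <= labs (a \join b).
Proof.
apply: (le_trans (meet_join_le _ _ _)); rewrite leUx; apply/andP; split.
  apply: (le_trans (leIr _ _)); apply: (le_trans _ (labs_ge _)); exact: leUr.
rewrite meetC; apply: (le_trans (meet_join_le _ _ _)).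
rewrite leUx; apply/andP; split.
  apply: (le_trans (leIr _ _)); apply: (le_trans _ (labs_ge _)); exact: leUl.
by rewrite meetC -oppJ labs_geN.
Qed.

(* Induction step of the distance estimate of [m] to the grid of the multiples of
   [e] in [crossing_grid]. *)
Lemma grid_step m c e : 0 <= e ->
  (e + lpos (labs m - c)) \meet (labs (m - (c + e)) \meet labs (m + (c + e)))
    <= e + lpos (labs m - (c + e)).
Proof.
move=> e0; set c' := c + e.
have le1 : labs (m - c') \meet labs (m + c') <= labs (labs m - c').
  rewrite -(labsN (m + c')) [- (m + c')]opprD [labs m]/labs joinDr; exact: labs_join_ge.
apply: (le_trans (meet_mono (lexx _) le1)).
have -> : labs m - c' = (labs m - c) - e by rewrite opprD addrA.
set s := labs m - c; rewrite {1}/labs.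
apply: (le_trans (meet_join_le _ _ _)); rewrite leUx; apply/andP; split.
  apply: (le_trans (leIr _ _)); apply: (le_trans (lpos_ge _)); exact: le_addl.
rewrite opprB -meetDl le_add2l; apply: (le_trans _ (lpos_ge0 _)).
by rewrite -(lpos_disj s) meet_mono// lpos_ge.
Qed.

(* [crossing m g t] is the part of the lattice on which [m - g <= t <= m + g]. *)
Definition crossing m g t : E := lpos (t - (m - g)) \meet lpos (m + g - t).

Lemma crossing_ge0 m g t : 0 <= crossing m g t.
Proof. by rewrite meet_ge0 ?lpos_ge0. Qed.

(** Without the positive parts, the crossing is exactly [g - labs (m - t)]. *)
Lemma crossing_ge m g t : g <= labs (m - t) + crossing m g t.
Proof.
rewrite addrC -le_subr; apply: (@le_trans _ _ ((t - (m - g)) \meet (m + g - t))).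
  rewrite opprB addrCA -(addrA m) [_ + (g - t)]addrCA -meetDl le_add2l.
  by rewrite /labs oppJ opprK opprB.
by rewrite meet_mono ?lpos_ge.
Qed.

(** The nearest grid level is within [e + lpos (labs m - n%:R *: e)] of [m], and [crossing_ge]
    bounds [g] by distance plus crossing. The meet in [grid_step] replaces the choice of a nearest
    level: its first term is bounded below by induction, the other two by [crossing_ge] at the two
    new levels. *)
Lemma crossing_grid m g e n : 0 <= e ->
  g <= \sum_(j < n.+1) (crossing m g (j%:R *: e) + crossing m g (- (j%:R *: e)))
       + (e + lpos (labs m - n%:R *: e)).
Proof.
move=> e0.
have cr t : 0 <= crossing m g t by exact: crossing_ge0.
elim: n => [|n IH].
  rewrite big_ord_recr big_ord0/= add0r scale0r !subr0 lpos_pos ?labs_ge0//.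
  apply: (le_trans (crossing_ge m g 0)); rewrite subr0 oppr0 addrC; apply: le_add.
    exact: le_addl.
  exact: le_addl.
rewrite big_ord_recr/=; set Sn := \sum_(_ < _) _; set D := (X in Sn + X).
have D0 : 0 <= D by exact: le_add0.
rewrite addrC -le_subr.
have -> : n.+1%:R *: e = n%:R *: e + e by rewrite -natr1 scalerDl scale1r.
apply: (le_trans _ (grid_step m (n%:R *: e) e0)).
rewrite !lexI; apply/and3P; split.
- rewrite le_subr addrC; apply: (le_trans IH).
  by rewrite -/Sn le_add2r le_addr.
- rewrite le_subr; apply: (le_trans (crossing_ge m g (n%:R *: e + e))); rewrite le_add2l.
  have Sn0 : 0 <= Sn by apply: le_sum0 => j _; exact: le_add0.
  rewrite /D -natr1 scalerDl scale1r.
  by apply: (le_trans (le_addr _ (cr (- (n%:R *: e + e))))); exact: le_addl.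
- rewrite le_subr; apply: (le_trans (crossing_ge m g (- (n%:R *: e + e)))).
  have Sn0 : 0 <= Sn by apply: le_sum0 => j _; exact: le_add0.
  rewrite opprK le_add2l /D -natr1 scalerDl scale1r.
  by apply: (le_trans (le_addl _ (cr (n%:R *: e + e)))); exact: le_addl.
Qed.

Lemma midpointB p r : 2^-1 *: (p + r) - 2^-1 *: (r - p) = p.
Proof.
by rewrite -scalerBr opprB addrACA subrr addr0 scalerDr -scalerDl
  -[2^-1]mul1r -splitr scale1r.
Qed.

Lemma midpointD p r : 2^-1 *: (p + r) + 2^-1 *: (r - p) = r.
Proof.
rewrite -scalerDr addrC addrA subrK.
by rewrite scalerDr -scalerDl -[2^-1]mul1r -splitr scale1r.
Qed.

(* Write [P] and [N] for the sums of the positive and of the negative parts of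
   [x - t] and [y - t]: then [labs (P - N)] falls short of [P + N] by twice the
   meet of [P] and [N], which dominates the crossing. *)
Lemma convexity_defect x y t :
  labs ((x - t) + (y - t)) +
    2%:R *: crossing (2^-1 *: (x + y)) (2^-1 *: (x \join y - x \meet y)) t
  <= labs (x - t) + labs (y - t).
Proof.
set d := crossing _ _ _; rewrite scaler_nat mulr2n.
have dE : d = lpos (t - x \meet y) \meet lpos (x \join y - t).
  by rewrite /d /crossing -(joinD_meet x y) [_ + x \meet y]addrC midpointB midpointD.
set a := x - t; set b := y - t.
have dP : d <= lpos a + lpos b.
  rewrite dE; apply: (le_trans (leIr _ _)); rewrite joinDr lpos_le leUx.
  rewrite le_add0 ?lpos_ge0// andbT; apply/andP; split.
    by apply: (le_trans (lpos_ge _)); rewrite le_addr ?lpos_ge0.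
  by apply: (le_trans (lpos_ge _)); rewrite le_addl ?lpos_ge0.
have dN : d <= lpos (- a) + lpos (- b).
  rewrite dE; apply: (le_trans (leIl _ _)); rewrite oppM joinDl lpos_le leUx.
  rewrite le_add0 ?lpos_ge0// andbT -[t - x]opprB -[t - y]opprB -/a -/b; apply/andP; split.
    by apply: (le_trans (lpos_ge _)); rewrite le_addr ?lpos_ge0.
  by apply: (le_trans (lpos_ge _)); rewrite le_addl ?lpos_ge0.
have abE : labs a + labs b = (lpos a + lpos b) + (lpos (- a) + lpos (- b)).
  by rewrite -!lposD addrACA.
have ab : a + b = (lpos a + lpos b) - (lpos (- a) + lpos (- b)).
  by rewrite opprD [RHS]addrACA !lposB.
rewrite -le_subl abE; set P := _ + lpos b in dP ab *; set N := _ + _ in dN ab *.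
clearbody P N; rewrite ab labs_le opprB; apply/andP; split.
  by rewrite le_subl -addrA le_add2l addrC le_subr le_add.
by rewrite le_subl [P + N]addrC -addrA le_add2l addrC le_subr le_add.
Qed.

Lemma labsB_le x y : labs (x - y) <= x \join y - x \meet y.
Proof.
rewrite labs_le opprB; apply/andP; split; apply: le_add; rewrite ?leUl ?leUr//.
  by rewrite le_oppr2 leIr.
by rewrite le_oppr2 leIl.
Qed.

Lemma le_cvg (u : E ^nat) l y : u @ \oo --> l ->
  (\forall n \near \oo, y <= u n) -> y <= l.
Proof.
move=> ul yu; suff : lpos (y - l) = 0.
  by move=> h; rewrite -(le_add2r (- l)) subrr -h lpos_ge.
apply/eqP; rewrite -normr_le0; apply/ler_addgt0Pr => eps eps0; rewrite add0r.
near \oo => n.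
apply: (@le_trans _ _ `|l - u n|); last first.
  by apply: ltW; near: n; move/cvgrPdist_lt : ul; exact.
rewrite -[`|l - u n|]normrN opprB; apply: norm_le.
rewrite (labs_pos (lpos_ge0 _)) lpos_le labs_ge0 andbT.
apply: (le_trans _ (labs_ge _)); rewrite le_add2r.
by near: n.
Unshelve. all: by end_near. Qed.

(** [v] is the sum of the series of the [2 ^- n *: x n], which converges absolutely in a complete
    space. *)
Lemma majorant (x : E ^nat) (M : R) : (forall n, 0 <= x n) ->
  (forall n, `|x n| <= M) ->
  exists2 v : E, 0 <= v & forall n, x n <= 2 ^+ n *: v.
Proof.
move=> x0 xM; pose u n := (2^-1) ^+ n *: x n.
have u0 n : 0 <= u n by rewrite scale_ge0// exprn_ge0// invr_ge0.
have cu : cvgn (series u).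
  apply: normed_cvg; apply: (@series_le_cvg _ _ (geometric M 2^-1)).
  - by move=> n /=.
  - by move=> n; rewrite /= mulr_ge0// ?exprn_ge0// ?invr_ge0// (le_trans _ (xM 0%N)).
  - move=> n /=; rewrite normrZ ger0_norm ?exprn_ge0 ?invr_ge0// mulrC.
    by rewrite ler_wpM2r// exprn_ge0// invr_ge0.
  - by apply: is_cvg_geometric_series; rewrite ger0_norm ?invr_ge0// invf_lt1// ltr1n.
have leu (n m : nat) : (n <= m)%N -> series u n <= series u m.
  move=> /subnK <-; elim: (m - n)%N => // k IH; apply: (le_trans IH).
  by rewrite addSn /series/= big_nat_recr//= le_addr.
have uv n : u n <= lim (series u @ \oo).
  apply: (le_cvg cu); near=> m; apply: (@le_trans _ _ (series u n.+1)).
    rewrite /series/= big_nat_recr//= le_addl//.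
    exact: le_sum0.
  by apply: leu; near: m; exact: nbhs_infty_ge.
exists (lim (series u @ \oo)); first exact: le_trans (u0 0%N) (uv 0%N).
move=> n; have := @le_scale (2 ^+ n) _ _ (exprn_ge0 _ (ler0n _ _)) (uv n).
by rewrite scalerA -exprMn divff ?pnatr_eq0// expr1n scale1r.
Unshelve. all: by end_near. Qed.

(** For [n < m], [y n] lies below the positive part of [x n - 2 ^- n *: v] and [y m] below a
    multiple of its negative part: the subtracted sum contains [x n], and [x m <= 2 ^+ m *: v] is
    absorbed because [2 ^+ m <= 2 ^+ m * 2 ^+ m * 2 ^- n]. *)
Lemma disjointification (x : E ^nat) v : (forall n, 0 <= x n) -> 0 <= v ->
  (forall n, x n <= 2 ^+ n *: v) ->
  let y n := lpos (x n - (2 ^+ n * 2 ^+ n) *: (\sum_(i < n) x i) - 2 ^- n *: v) in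
  forall n m : nat, n != m -> y n \meet y m = 0.
Proof.
move=> x0 v0 xv y.
have S0 n : 0 <= \sum_(i < n) x i.
  exact: le_sum0.
have p0 n : 0 < 2 ^+ n :> R by rewrite exprn_gt0.
suff h (n m : nat) : (n < m)%N -> y n \meet y m = 0.
  by move=> n m; case: ltngtP => // nm _; [exact: h|rewrite meetC; exact: h].
move=> nm; set w := lpos (x n - 2 ^- n *: v).
set w' := lpos (- (x n - 2 ^- n *: v)).
have yn : y n <= w.
  apply: lpos_mono; rewrite le_add2r le_subr le_addr// scale_ge0//.
have ym : y m <= (2 ^+ m * 2 ^+ m) *: w'.
  have c0 : 0 <= 2 ^+ m * 2 ^+ m :> R by rewrite mulr_ge0// ltW.
  rewrite /w' -lposZ//; apply: lpos_mono.
  apply: (@le_trans _ _ (x m - (2 ^+ m * 2 ^+ m) *: x n)).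
    rewrite le_subr -[leLHS]addr0 le_add//; last first.
      by rewrite scale_ge0// invr_ge0 ltW.
    rewrite le_add2l le_oppr2 le_scale//.
    rewrite (bigD1 (Ordinal nm))//= le_addr//.
    exact: le_sum0.
  rewrite opprB scalerBr le_add2r; apply: (le_trans (xv m)).
  rewrite scalerA; apply: le_scalel => //.
  rewrite -mulrA; apply: ler_peMr; first exact: ltW.
  by rewrite ler_pdivlMr// mul1r ler_eXn2l ?ltr1n// ltnW.
apply: (meet_disj_le _ _ yn ym); rewrite ?lpos_ge0//.
rewrite meetC; apply: meet_scale_le; rewrite ?lpos_ge0//.
by rewrite meetC lpos_disj.
Qed.

(** Indexed by the last offset [i], so that a block is never empty: the lattice need not have a
    least element. *)
Fixpoint block_join (u : nat -> E) n i : E :=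
  if i is i'.+1 then block_join u n i' \join u (n + i)%N else u n.

Lemma block_join_mem (u : nat -> E) n i (k : nat) :
  (k <= i)%N -> u (n + k)%N <= block_join u n i.
Proof.
elim: i => [|i IH]; first by rewrite leqn0 => /eqP->; rewrite addn0.
rewrite leq_eqVlt => /predU1P[->|]; first exact: leUr.
by rewrite ltnS => /IH /le_trans; apply; exact: leUl.
Qed.

Lemma block_join_le (u : nat -> E) n i v :
  (forall k : nat, (k <= i)%N -> u (n + k)%N <= v) -> block_join u n i <= v.
Proof.
elim: i => [|i IH] h; first by have := h 0%N (leqnn _); rewrite addn0.
by rewrite /= leUx IH ?h// => k ki; apply: h; exact: leqW.
Qed.

Lemma block_join_sub (u : nat -> E) n i n' i' : (n <= n')%N -> (n' + i' <= n + i)%N ->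
  block_join u n' i' <= block_join u n i.
Proof.
move=> nn' le; apply: block_join_le => k ki.
have -> : (n' + k = n + (n' + k - n))%N by rewrite subnKC// (leq_trans nn')// leq_addr.
by apply: block_join_mem; rewrite leq_subLR (leq_trans _ le)// leq_add2l.
Qed.

Lemma block_join_ge0 (u : nat -> E) n i : 0 <= u n -> 0 <= block_join u n i.
Proof.
by move=> un; have := @block_join_mem u n i 0 isT; rewrite addn0; exact: le_trans.
Qed.

Lemma disjoint_sum (x : E ^nat) n u : 0 <= u ->
  (forall i, (i < n)%N -> labs (x i) \meet u = 0) ->
  labs (\sum_(i < n) x i) \meet u = 0.
Proof.
move=> u0; elim: n => [|n IH] h.
  by rewrite big_ord0 labs0; apply/le_anti; rewrite leIl meet_ge0.
rewrite big_ord_recr/=; apply/le_anti; rewrite meet_ge0 ?labs_ge0// andbT.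
apply: (le_trans (meet_mono (labsD _ _) (lexx u))).
apply: (le_trans (meetD_le _ _ _)); rewrite ?labs_ge0//.
by rewrite h// IH ?addr0// => i ilt; apply: h; exact: ltnW.
Qed.

Lemma disjoint_labsD x y : labs x \meet labs y = 0 ->
  labs (x + y) <= labs x \join labs y.
Proof. by move=> h; apply: (le_trans (labsD x y)); rewrite -joinD_meet h addr0. Qed.

(** For disjoint elements the sum of the moduli is their join, and the norm of a join is a
    maximum. *)
Lemma AM_disjoint_sum (x : E ^nat) n (M : R) : AM_space E -> 0 <= M ->
  (forall i, `|x i| <= M) ->
  (forall i j, i != j -> labs (x i) \meet labs (x j) = 0) ->
  `|\sum_(i < n) x i| <= M.
Proof.
move=> AM M0 xM dx; elim: n => [|n IH]; first by rewrite big_ord0 normr0.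
rewrite big_ord_recr/=.
apply: (@le_trans _ _ `|labs (\sum_(i < n) x i) \join labs (x n)|).
  apply: norm_le_pos; apply: disjoint_labsD; apply: disjoint_sum.
    exact: labs_ge0.
  by move=> i ilt; apply: dx; rewrite ltn_eqF.
by rewrite AM ?labs_ge0// !norm_labs ge_max IH xM.
Qed.

End vector_lattice.

(** * The Hahn-Banach theorem *)

Section sublinear.
Context {R : realType} {V : lmodType R}.
Implicit Types (p q f : V -> R) (x y z : V) (k : R).

Definition sublinear p :=
  (forall x y, p (x + y) <= p x + p y) /\
  (forall k x, 0 <= k -> p (k *: x) = k * p x).

Lemma sublinear_ge p x : sublinear p -> - p (- x) <= p x.
Proof.
move=> [pD pZ]; have p0 : p 0 = 0 by rewrite -(scale0r (0 : V)) pZ// mul0r.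
by rewrite lerNl -subr_ge0 opprK -p0 -(addNr x) pD.
Qed.

(** The largest sublinear functional below [p] whose value at [- z] is at most [- p z]. *)
Definition sublinear_shift p z y : R :=
  inf [set p (y + k *: z) - k * p z | k in [set k | 0 <= k]].

Section shift.
Variables (p : V -> R) (z : V).
Hypothesis p_sub : sublinear p.

Let S y := [set p (y + k *: z) - k * p z | k in [set k | 0 <= k]].

Let lbS y r : S y r -> - p (- y) <= r.
Proof.
have [pD pZ] := p_sub.
move=> [k k0 <-]; rewrite -pZ//; have := pD (- y) (y + k *: z).
by rewrite addKr; lra.
Qed.

Let has_infS y : has_inf (S y).
Proof.
split; first by exists (p (y + 0 *: z) - 0 * p z), 0 => /=.
by exists (- p (- y)) => r /lbS.
Qed.

Let shift_le y k : 0 <= k -> sublinear_shift p z y <= p (y + k *: z) - k * p z.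
Proof. by move=> k0; apply: ge_inf; [exact: (has_infS y).2|exists k]. Qed.

Lemma sublinear_shift_le y : sublinear_shift p z y <= p y.
Proof.
apply: (le_trans (shift_le y (lexx 0))).
by rewrite scale0r addr0 mul0r subr0.
Qed.

Lemma sublinear_shiftN : sublinear_shift p z (- z) <= - p z.
Proof.
have [pD pZ] := p_sub.
apply: (le_trans (shift_le (- z) ler01)).
rewrite scale1r addNr mul1r.
by rewrite -(scale0r (0 : V)) pZ// mul0r sub0r.
Qed.

Lemma sublinear_shift_sublinear : sublinear (sublinear_shift p z).
Proof.
have [pD pZ] := p_sub.
have leS y r : r <= sublinear_shift p z y <-> forall k, 0 <= k ->
    r <= p (y + k *: z) - k * p z.
  split=> [h k k0|h]; first exact: le_trans h (shift_le y k0).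
  apply: lb_le_inf; first exact: (has_infS y).1.
  by move=> _ [k k0 <-]; exact: h.
split=> [x y|k x].
  rewrite -lerBlDl; apply/leS => k k0; rewrite lerBlDl -lerBlDr.
  apply/leS => l l0; rewrite lerBlDr.
  apply: (le_trans (shift_le _ (addr_ge0 l0 k0))).
  rewrite scalerDl mulrDl addrACA.
  have := pD (x + l *: z) (y + k *: z); lra.
rewrite le_eqVlt => /predU1P[<-|k0].
  rewrite mul0r scale0r; apply/le_anti/andP; split.
    apply: (le_trans (sublinear_shift_le _)).
    by rewrite -(scale0r (0 : V)) pZ// mul0r.
  apply/leS => l l0; rewrite add0r pZ// subrr//.
apply/le_anti/andP; split.
  rewrite -ler_pdivrMl//; apply/leS => l l0; rewrite ler_pdivrMl//.
  apply: (le_trans (shift_le _ (mulr_ge0 (ltW k0) l0))).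
  by rewrite -scalerA -scalerDr (pZ _ _ (ltW k0)) mulrBr mulrA.
apply/leS => l l0; rewrite -ler_pdivlMl//.
apply: (le_trans (shift_le _ (mulr_ge0 (_ : 0 <= k^-1) l0))).
  by rewrite invr_ge0 ltW.
rewrite ler_pdivlMl// mulrBr mulrA mulrA divff ?gt_eqF// mul1r lerD2r.
by rewrite -(pZ _ _ (ltW k0)) scalerDr scalerA mulrA divff ?gt_eqF// mul1r.
Qed.

End shift.

(* A minimal sublinear functional [q] is linear, since [sublinear_shift q z] lies
   below [q] and forces [q (- z) <= - q z]. *)
Lemma sublinear_minimal p : sublinear p -> exists q,
  [/\ sublinear q, forall x, q x <= p x &
      forall r, sublinear r -> (forall x, r x <= q x) -> r = q].
Proof.
move=> p_sub; pose T := {q : V -> R | sublinear q /\ forall x, q x <= p x}.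
(* The order is reversed, since [Zorn] yields maximal elements. *)
pose le (q r : T) := `[< forall x, sval r x <= sval q x >].
have [|r s t|q r|A totA|q qmin] := @Zorn T le.
- by move=> t; exact/asboolP.
- by move=> /asboolP rs /asboolP st; apply/asboolP => x; exact: le_trans (rs x).
- move=> /asboolP qr /asboolP rq; case: q r qr rq => q hq [r hr] /= qr rq.
  apply: eq_exist; apply/funext => x.
  by apply/le_anti; rewrite qr rq.
- have [[q0 Aq0]|A0] := pselect (A !=set0); last first.
    have pT : sublinear p /\ forall x, p x <= p x by [].
    exists (exist _ p pT : T) => s As; exfalso; apply: A0; by exists s.
  pose S x := [set sval q x | q in A].
  have lbS x r : S x r -> - p (- x) <= r.
    move=> [q Aq <-]; have [qs qp] := svalP q.
    by apply: (le_trans _ (sublinear_ge x qs)); rewrite lerN2.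
  have infS x : has_inf (S x).
    split; first by exists (sval q0 x), q0.
    by exists (- p (- x)) => r /lbS.
  pose q x := inf (S x).
  have qle x t : A t -> q x <= sval t x.
    by move=> At; apply: ge_inf; [exact: (infS x).2|exists t].
  have qge x r : (forall t, A t -> r <= sval t x) -> r <= q x.
    move=> h; apply: lb_le_inf; first exact: (infS x).1.
    by move=> _ [t At <-]; exact: h.
  have qs : sublinear q.
    split=> [x y|k x].
      rewrite -lerBlDl; apply/qge => t At; rewrite lerBlDl -lerBlDr.
      apply/qge => s As; rewrite lerBlDr.
      have [[tD _] _] := svalP t; have [[sD _] _] := svalP s.
      (* The two infima may be approached by different members of the chain; the smaller one serves
         for both. *)
      have [/asboolP ts|/asboolP st] := totA _ _ At As.
        apply: (le_trans (qle _ _ As)); apply: (le_trans (sD _ _)).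
        by rewrite lerD2l.
      apply: (le_trans (qle _ _ At)); apply: (le_trans (tD _ _)).
      by rewrite lerD2r.
    rewrite le_eqVlt => /predU1P[<-|k0].
      rewrite mul0r scale0r.
      have t0 (t : T) : sval t 0 = 0.
        have [[_ tZ] _] := svalP t.
        by rewrite -(scale0r (0 : V)) tZ// mul0r.
      apply/le_anti/andP; split; first by rewrite -(t0 q0) qle.
      by apply/qge => t At; rewrite t0.
    apply/le_anti/andP; split.
      rewrite -ler_pdivrMl//; apply/qge => t At; rewrite ler_pdivrMl//.
      have [[_ tZ] _] := svalP t.
      by rewrite -(tZ _ _ (ltW k0)) qle.
    apply/qge => t At; rewrite -ler_pdivlMl//.
    have [[_ tZ] _] := svalP t.
    by rewrite (tZ _ _ (ltW k0)) mulKf ?gt_eqF// qle.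
  have qp x : q x <= p x.
    by apply: (le_trans (qle x _ Aq0)); exact: (svalP q0).2.
  exists (exist _ q (conj qs qp) : T) => t At; apply/asboolP => x /=.
  exact: qle.
- have [qs qp] := svalP q.
  exists (sval q); split=> // r rs rq.
  have rp x : r x <= p x by exact: le_trans (rq x) (qp x).
  have := qmin (exist _ r (conj rs rp) : T).
  by move=> /(_ _)/(congr1 sval)/=; apply; exact/asboolP.
Qed.

Lemma hahn_banach p v : sublinear p ->
  exists f : V -> R, [/\ scalar f, forall x, f x <= p x & f v = p v].
Proof.
(* Minimising below the shift by [v] forces [f (- v) <= - p v], hence [f v = p v]. *)
move=> ps; have [f [fs fp fmin]] := sublinear_minimal (sublinear_shift_sublinear v ps).
have fN x : f (- x) = - f x.
  apply/le_anti/andP; split; last by have := sublinear_ge (- x) fs; rewrite opprK.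
  rewrite -{1}(fmin _ (sublinear_shift_sublinear x fs) (sublinear_shift_le x fs)).
  exact: sublinear_shiftN.
have [fD fZ] := fs.
have fD' x y : f (x + y) = f x + f y.
  apply/le_anti; rewrite fD/=.
  rewrite -[leRHS]opprK -fN opprD lerNr; apply: (le_trans _ (lexx _)).
  by apply: (le_trans (fD _ _)); rewrite !fN opprD.
exists f; split=> [k x y|x|].
- rewrite fD'; congr (_ + _).
  have [k0|k0] := leP 0 k; first exact: fZ.
  by rewrite -[k]opprK scaleNr fN fZ ?mulNr// oppr_ge0 ltW.
- exact: le_trans (fp x) (sublinear_shift_le v ps x).
- apply/le_anti/andP; split.
    exact: le_trans (fp v) (sublinear_shift_le v ps v).
  by rewrite -[f v]opprK -fN lerNr (le_trans (fp _))// sublinear_shiftN.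
Qed.

End sublinear.

(** * Bounded functionals and the weak topology *)

Section scalar_functionals.
Context {R : realType} {V : lmodType R} (f : V -> R) (sf : scalar f).

Lemma scalarD x y : f (x + y) = f x + f y.
Proof. by have := sf 1 x y; rewrite scale1r mul1r. Qed.

Lemma scalar0 : f 0 = 0.
Proof. by apply: (addrI (f 0)); rewrite -scalarD !addr0. Qed.

Lemma scalarZ k x : f (k *: x) = k * f x.
Proof. by have := sf k x 0; rewrite !addr0 scalar0 addr0. Qed.

Lemma scalarN x : f (- x) = - f x.
Proof. by rewrite -scaleN1r scalarZ mulN1r. Qed.

Lemma scalarB x y : f (x - y) = f x - f y.
Proof. by rewrite scalarD scalarN. Qed.

Lemma scalar_sum (I : Type) (r : seq I) (P : pred I) (x : I -> V) :
  f (\sum_(i <- r | P i) x i) = \sum_(i <- r | P i) f (x i).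
Proof. exact: (big_morph f scalarD scalar0). Qed.

End scalar_functionals.

(** * Limits along ultrafilters *)

Section ultrafilters.

Lemma ultra_fmap (T U : Type) (f : T -> U) (F : set_system T) :
  UltraFilter F -> UltraFilter (f @ F).
Proof.
move=> FU; split=> [|G GF FG]; first exact: fmap_proper_filter.
apply/seteqP; split=> // B GB.
have [//|nB] := in_ultra_setVsetC (f @^-1` B) FU.
have /FG GnB : (f @ F) (~` B) by [].
by exfalso; apply: (@filter_not_empty _ G); rewrite -(setICr B); exact: filterI.
Qed.

Lemma ultra_infty : exists2 U : set_system nat, UltraFilter U & \oo `<=` U.
Proof. by have [U [UU sU]] := ultraFilterLemma eventually_filter; exists U. Qed.

Context {R : realType}.

Lemma ultra_cvg (I : Type) (U : set_system I) (x : I -> R) (M : R) :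
  UltraFilter U -> U [set i | `|x i| <= M] -> exists l : R, x i @[i --> U] --> l.
Proof.
move=> UU xM; have UF := ultra_fmap x UU.
have := @segment_compact R (- M) M; rewrite compact_ultra => /(_ _ UF).
case; last by move=> l [_ xl]; exists l.
have : U [set i | x i \in `[(- M)%R, M]].
    by apply: filterS xM => i /=; rewrite in_itv/= -ler_norml.
  by [].
Qed.

End ultrafilters.

Section bounded_functionals.
Context {R : realType} {V : normedModType R}.
Implicit Types (f : V -> R) (M : R).

Definition bounded_functional f M := scalar f /\ forall x, `|f x| <= M * `|x|.

Lemma bounded_functionalZ k f M : bounded_functional f M ->
  bounded_functional (fun x => k * f x) (`|k| * M).
Proof.
move=> [sf fM]; split=> [a x y|x]; first by rewrite sf; ring.
by rewrite normrM -mulrA ler_wpM2l.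
Qed.

Lemma bounded_functional_continuous f M : bounded_functional f M -> continuous f.
Proof.
move=> [sf fM] x; apply/cvgrPdist_le => e e0.
have M0 : 0 < `|M| + 1 by rewrite ltr_wpDl.
near=> y; rewrite -scalarB//; apply: (le_trans (fM _)).
apply: (@le_trans _ _ ((`|M| + 1) * `|x - y|)).
  by rewrite ler_wpM2r// (le_trans (ler_norm M))// lerDl.
rewrite -ler_pdivlMl//; near: y; apply: cvgr_dist_le => //.
by rewrite mulr_gt0// invr_gt0.
Unshelve. all: by end_near. Qed.

Lemma topological_dualP f :
  topological_dual f <-> exists2 M, 0 <= M & bounded_functional f M.
Proof.
split=> [[sf cf]|[M M0 fM]]; last first.
  by split; [exact: fM.1|exact: bounded_functional_continuous fM].
have /cvgrPdist_lt/(_ 1 ltr01) := cf 0.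
rewrite (scalar0 sf) => /nbhs_normP[d /= d0 fd].
exists (2 / d); first by rewrite divr_ge0// ltW.
split=> // x; have [->|x0] := eqVneq x 0; first by rewrite (scalar0 sf) !normr0 mulr0.
have nx : 0 < `|x| by rewrite normr_gt0.
pose k := d / (2 * `|x|).
have k0 : 0 < k by rewrite divr_gt0// mulr_gt0.
have := fd (k *: x); rewrite /= !sub0r !normrN normrZ (gtr0_norm k0).
rewrite (scalarZ sf) normrM (gtr0_norm k0) => h.
have kx : k * `|x| = d / 2 by rewrite /k; field; rewrite gt_eqF.
have : k * `|f x| < 1.
  by apply: h; rewrite kx ltr_pdivrMr// ltr_pMr// ltr1n.
rewrite -ltr_pdivlMl// mulr1 => /ltW/le_trans; apply.
by rewrite /k le_eqVlt; apply/orP; left; apply/eqP; field; rewrite !gt_eqF.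
Qed.

Lemma norming_functional x :
  exists2 f : V -> R, bounded_functional f 1 & f x = `|x|.
Proof.
have [|f [sf fp fx]] := @hahn_banach R V (fun x => `|x|) x.
  by split=> [y z|k y k0]; [exact: ler_normD|rewrite normrZ ger0_norm].
exists f => //; split=> // y; rewrite mul1r ler_norml fp andbT.
by rewrite lerNl -scalarN// -[leRHS]normrN fp.
Qed.

(** The form in which weak-star compactness of dual balls is used: pointwise limits along an
    ultrafilter. *)
Lemma bounded_functional_lim (I : Type) (U : set_system I) (f : I -> V -> R) M :
  UltraFilter U -> (forall i, bounded_functional (f i) M) ->
  exists2 g, bounded_functional g M & forall x, f i x @[i --> U] --> g x.
Proof.
move=> UU fM.
have h : forall x, exists l : R, f i x @[i --> U] --> l.
  move=> x; apply: (@ultra_cvg _ _ _ _ (M * `|x|)); apply: nearW => i.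
  exact: (fM i).2.
have [g fg] := boolp.choice h.
exists g => //; split=> [k x y|x].
  have h1 : f i (k *: x + y) @[i --> U] --> k * g x + g y.
    under eq_fun do rewrite (fM _).1.
    by apply: cvgD; [apply: cvgMr|]; exact: fg.
  by rewrite -(cvg_lim _ h1)// -(cvg_lim _ (fg _)).
have nfg : `|f i x| @[i --> U] --> `|g x| by apply: cvg_norm; exact: fg.
rewrite -(cvg_lim _ nfg)//; apply: limr_le; first by apply/cvg_ex; exists `|g x|.
by apply: nearW => i; exact: (fM i).2.
Qed.

End bounded_functionals.

Section functional_topology_cvg.
Context {R : realType}.

Lemma functional_cvgP (V : choiceType) (S : set (V -> R)) (I : Type)
    (F : set_system I) (x : I -> V) (p : V) : Filter F ->
  (x @ F --> (p : functional_topology S)) <->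
  (forall f, S f -> f (x i) @[i --> F] --> f p).
Proof.
move=> FF; have FxF : Filter (x @ F) by exact: fmap_filter.
rewrite -[X in X <-> _]/((x @ F : set_system V) --> (p : functional_topology S)).
split=> [xp f Sf|xf].
  move/(@cvg_sup V _ _ (x @ F) p FxF)/(_ (exist _ f Sf)) : xp => xp.
  apply: (cvg_comp x f xp).
  exact: (@initial_continuous V R f p).
apply/(@cvg_sup V _ _ (x @ F) p FxF) => -[f Sf] A.
rewrite nbhsE => -[_ [[B oB <-] Bp] BA].
apply: (filterS BA); apply: (xf f Sf).
exact: open_nbhs_nbhs.
Qed.

Lemma functional_continuous (V : choiceType) (S : set (V -> R)) f : S f ->
  continuous (f : functional_topology S -> R).
Proof.
move=> Sf p; have FF : Filter (nbhs (p : functional_topology S)) by exact: nbhs_filter.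
by apply: ((functional_cvgP S id p FF).1 _ f Sf); exact: cvg_id.
Qed.

Context {X : normedModType R}.

Lemma weak_cvgP (I : Type) (F : set_system I) (x : I -> X) (p : X) : Filter F ->
  (x @ F --> (p : weak X)) <->
  (forall f M, bounded_functional f M -> f (x i) @[i --> F] --> f p).
Proof.
move=> FF; split=> [/functional_cvgP xp f M fM|h].
  apply: xp; split; [exact: fM.1|exact: bounded_functional_continuous fM].
by apply/functional_cvgP => f /topological_dualP[M _ fM]; exact: h fM.
Qed.

(** The criterion only sees ultrafilters on [A], whereas compactness concerns the weak closure. An
    ultrafilter on the closure is therefore replaced by one containing the traces on [A] of its
    weakly open members. *)
Lemma relatively_weakly_compactP (A : set X) :
  relatively_weakly_compact A <->
  forall G : set_system X, UltraFilter G -> G A ->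
    exists p, forall f M, bounded_functional f M -> f @ G --> f p.
Proof.
rewrite /relatively_weakly_compact precompactE compact_ultra; split=> [cA G UG GA|h].
  have [|p [_ Gp]] := cA G UG.
    by apply: filterS GA; exact: (@subset_closure (weak X)).
  by exists p; apply/(weak_cvgP id p).
move=> F FU FA.
pose G0 : set_system X := [set B | exists2 W, F W /\ @open (weak X) W & A `&` W `<=` B].
have G0F : ProperFilter G0.
  apply: Build_ProperFilter_ex.
    move=> B [W [FO oO] AOB].
    have [x [cx Ox]] := filter_ex (filterI FA FO).
    have [y [Ay Oy]] := cx W (open_nbhs_nbhs (conj oO Ox)).
    by exists y; exact: AOB.
  split.
  - by exists setT => //; split; [exact: filterT|exact: openT].
  - move=> B C [W [FO oO] OB] [Q [FQ oQ] QC]; exists (W `&` Q).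
      by split; [exact: filterI|exact: openI].
    by move=> x [Ax [Ox Qx]]; split; [exact: OB|exact: QC].
  - by move=> B C BC [W hO OB]; exists W => //; exact: subset_trans BC.
have [G [GU G0G]] := ultraFilterLemma G0F.
have [|p hp] := h G GU.
  by apply: G0G; exists setT => [|x []//]; split; [exact: filterT|exact: openT].
have Fp : F --> (p : weak X).
  apply/(weak_cvgP id p) => f M fM; apply/cvgrPdist_lt => e e0.
  have [//|nF] := in_ultra_setVsetC [set x : X | `|f p - f x| < e] FU.
  (* Only open members of [F] pass to [G]; halving [e] encloses the closed complement of the
     [e]-neighbourhood in an open set. *)
  pose W := [set x : X | e / 2 < `|f p - f x|].
  have GO : G W.
    apply: G0G; exists W => [|x []//]; split.
      apply: filterS nF => x /= /negP; rewrite -leNgt; apply: lt_le_trans.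
      by rewrite ltr_pdivrMr// ltr_pMr// ltr1n.
    apply: (@open_comp (weak X) R f [set y | e / 2 < `|f p - y|]).
      move=> x _; apply: functional_continuous; split; first exact: fM.1.
      exact: bounded_functional_continuous fM.
    apply: (@open_comp R R (fun y => `|f p - y|) [set r | e / 2 < r]).
      move=> y _; apply: cvg_norm; apply: cvgB; [exact: cvg_cst|exact: cvg_id].
    exact: open_gt.
  have /cvgrPdist_lt/(_ (e / 2)) := hp f M fM.
  rewrite divr_gt0// => /(_ isT) GO'.
  have [x [/= Ox Ox']] := filter_ex (filterI GO GO').
  by have := lt_trans Ox Ox'; rewrite ltxx.
exists p; split=> //.
apply: (@closed_closure (weak X) A) => N pN.
exact: filter_ex (filterI FA (Fp N pN)).
Qed.

Lemma relatively_weakly_compact_affine (A : set X) (k : R) (b : X) : k != 0 ->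
  relatively_weakly_compact A ->
  relatively_weakly_compact [set k *: x + b | x in A].
Proof.
move=> k0 /relatively_weakly_compactP cA; apply/relatively_weakly_compactP => G UG GA.
pose h (x : X) := k^-1 *: (x - b).
have [|p hp] := cA _ (ultra_fmap h UG).
  apply: (@filterS _ G _ [set k *: x + b | x in A]) => // _ [x Ax <-].
  by rewrite /h /= addrK scalerA mulVf// scale1r.
exists (k *: p + b) => f M fM.
have -> : f = (fun x => k * f (h x) + f b).
  apply/funext => x; rewrite -(scalarZ fM.1) -(scalarD fM.1) /h scalerA.
  by rewrite divff// scale1r subrK.
apply: cvgD; last exact: cvg_cst.
apply: cvgMr; rewrite /h addrK scalerA mulVf// scale1r.
exact: hp fM.
Qed.

End functional_topology_cvg.

(** * The uniform boundedness principle for sequences *)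

Section uniform_boundedness.
Context {R : realType} {V : normedModType R}.

(** The weights add up to [1 / 2]. With a limit along an ultrafilter, only the finite partial sums
    need an estimate. *)
Lemma bounded_functional_series (g : nat -> V -> R) :
  (forall j, bounded_functional (g j) 1) ->
  exists (U : set_system nat) (f : V -> R),
    [/\ UltraFilter U, \oo `<=` U, bounded_functional f 1 &
        forall y, \sum_(j < m) 3 ^- j.+1 * g j y @[m --> U] --> f y].
Proof.
move=> gb; have [U UU sU] := ultra_infty.
have [m|f fb hf] := @bounded_functional_lim R V nat U
  (fun m y => \sum_(j < m) 3 ^- j.+1 * g j y) 1 UU; last by exists U, f.
split=> [k x y|x].
  rewrite mulr_sumr -big_split/=; apply: eq_bigr => j _.
  by rewrite (gb j).1; ring.
rewrite mul1r; suff : `|\sum_(j < m) 3 ^- j.+1 * g j x| <=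
    2^-1 * (1 - 3 ^- m) * `|x|.
  move=> /le_trans; apply; rewrite ler_piMl//.
  have : 0 <= 3 ^- m :> R by rewrite invr_ge0 exprn_ge0.
  lra.
elim: m => [|m IH]; first by rewrite big_ord0 normr0 expr0 invr1 subrr mulr0 mul0r.
rewrite big_ord_recr/=; apply: (le_trans (ler_normD _ _)).
have p0 : 0 < 3 ^- m.+1 :> R by rewrite invr_gt0 exprn_gt0.
have e3 : 3 ^- m = 3 * 3 ^- m.+1 :> R.
  by rewrite exprS invfM mulrA divff ?mul1r// pnatr_eq0.
have h := (gb m).2 x; rewrite mul1r in h.
have : `|3 ^- m.+1 * g m x| <= 3 ^- m.+1 * `|x|.
  by rewrite normrM (gtr0_norm p0) ler_wpM2l// ltW.
move: IH; rewrite e3; lra.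
Qed.

(* A gliding hump: the signs in the series of norming functionals are chosen so
   that each partial sum is large at the corresponding [y k], and the ratio 1/3
   makes the tail too small to cancel it. *)
Lemma weakly_bounded (x : nat -> V) :
  (forall f M, bounded_functional f M -> exists C : R, forall n, `|f (x n)| <= C) ->
  exists C : R, forall n, `|x n| <= C.
Proof.
move=> wb; apply: contrapT => unb.
(* [4 ^+ k] outgrows the weights [3 ^- k.+1], so that [(4 / 3) ^+ k] will contradict the bound
   [C]. *)
have h k : exists n, 4 ^+ k < `|x n|.
  apply: contrapT => h; apply: unb; exists (4 ^+ k) => n; rewrite leNgt.
  by apply/negP => ?; apply: h; exists n.
have [phi hphi] := boolp.choice h.
pose y k := x (phi k).
have h2 k : exists f : V -> R, bounded_functional f 1 /\ f (y k) = `|y k|.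
  by have [f] := norming_functional (y k); exists f.
have [g gP] := boolp.choice h2.
pose sg (k : nat) (r : R) : R := if r < 0 then -1 else 1.
pose fix F k : V -> R := if k is k'.+1 then
  fun z => F k' z + 3 ^- k * (sg k' (F k' (y k')) * g k' z) else fun=> 0.
have sgN k r : `|sg k r| = 1.
  by rewrite /sg; case: ifP => _; rewrite ?normrN normr1.
pose s k := sg k (F k (y k)).
have Fsum k z : F k z = \sum_(j < k) 3 ^- j.+1 * (s j * g j z).
  by elim: k => [|k IH]; rewrite ?big_ord0// big_ord_recr/= -IH.
have Flow k : 3 ^- k.+1 * `|y k| <= `|F k.+1 (y k)|.
  rewrite /= (gP k).2 -/(s k).
  have c0 : 0 <= 3 ^- k.+1 * `|y k| by rewrite mulr_ge0// invr_ge0 exprn_ge0.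
  rewrite /s /sg; case: ltP => r0.
    rewrite mulN1r mulrN ler0_norm; last by lra.
    by lra.
  by rewrite mul1r ger0_norm; lra.
have [|U [f [UU sU fb hf]]] := @bounded_functional_series (fun j z => s j * g j z).
  move=> j; have := bounded_functionalZ (s j) (gP j).1.
  by rewrite /s sgN mulr1.
have [C hC] := wb f 1 fb.
(* The weights after the [k]-th add up to half of [3 ^- k.+1], so at most half of the bound in
   [Flow] is lost. *)
have flow k : 2^-1 * (3 ^- k.+1 * `|y k|) <= `|f (y k)|.
  suff : `|f (y k) - F k.+1 (y k)| <= 2^-1 * (3 ^- k.+1 * `|y k|).
    have := Flow k; have := ler_normD (F k.+1 (y k) - f (y k)) (f (y k)).
    by rewrite subrK distrC; lra.
  have lim : `|F m (y k) - F k.+1 (y k)| @[m --> U] --> `|f (y k) - F k.+1 (y k)|.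
    apply: cvg_norm; apply: cvgB; last exact: cvg_cst.
    by under eq_fun do rewrite Fsum; exact: hf.
  rewrite -(cvg_lim _ lim)//; apply: limr_le; first by apply/cvg_ex; eexists; exact: lim.
  apply: (@filterS _ U _ [set m | (k.+1 <= m)%N]); last first.
    by apply: sU; exact: nbhs_infty_ge.
  move=> m /= km.
  suff : `|F m (y k) - F k.+1 (y k)| <= 2^-1 * (3 ^- k.+1 - 3 ^- m) * `|y k|.
    move=> /le_trans; apply; rewrite mulrA ler_wpM2r// ler_pM2l ?invr_gt0//.
    by rewrite gerBl invr_ge0 exprn_ge0.
  rewrite -(subnK km); elim: (m - k.+1)%N => [|i IH].
    by rewrite add0n !subrr normr0 mulr0 mul0r.
  rewrite addSn; set j := (i + k.+1)%N in IH *.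
  rewrite /= addrAC; apply: (le_trans (ler_normD _ _)).
  have p0 : 0 < 3 ^- j.+1 :> R by rewrite invr_gt0 exprn_gt0.
  have e3 : 3 ^- j = 3 * 3 ^- j.+1 :> R.
    by rewrite exprS invfM mulrA divff ?mul1r// pnatr_eq0.
  have hg := (gP j).1.2 (y k); rewrite mul1r in hg.
  have : `|3 ^- j.+1 * (sg j (F j (y j)) * g j (y k))| <= 3 ^- j.+1 * `|y k|.
    by rewrite !normrM sgN mul1r (gtr0_norm p0) ler_wpM2l// ltW.
  move: IH; rewrite e3; lra.
have C0 : 0 <= C by rewrite (le_trans _ (hC 0%N)).
have hk k : (4 / 3) ^+ k <= 6 * C.
  have := flow k; have := hC (phi k); rewrite -/(y k) => a b.
  have : 2^-1 * (3 ^- k.+1 * 4 ^+ k) <= C.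
    apply: le_trans a; apply: le_trans b; rewrite ler_pM2l ?invr_gt0//.
    by rewrite ler_pM2l ?invr_gt0 ?exprn_gt0// ltW// hphi.
  rewrite expr_div_n exprS invfM; lra.
have [k] : exists k, 6 * C < (4 / 3) ^+ k :> R.
  have := @cvg_geometric R 1 (3 / 4).
  rewrite ger0_norm ?divr_ge0// ltr_pdivrMr// mul1r ltr_nat => /(_ isT).
  have d0 : 0 < (6 * C + 1)^-1 by rewrite invr_gt0 ltr_wpDl// mulr_ge0.
  move=> /cvgrPdist_lt/(_ _ d0)[k _ /(_ k (leqnn k))].
  rewrite /= mul1r sub0r normrN ger0_norm ?exprn_ge0 ?divr_ge0// => hlt.
  exists k; rewrite -[4 / 3]invrK invf_div exprVn.
  rewrite (@lt_trans _ _ (6 * C + 1))// ?ltrDl// -ltf_pV2 ?invrK//.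
  - by rewrite posrE invr_gt0 exprn_gt0// divr_gt0.
  - by rewrite posrE ltr_wpDl// mulr_ge0.
by rewrite ltNge hk.
Qed.

End uniform_boundedness.

(** * Functionals on Banach lattices *)

Section positive_functionals.
Context {R : realType} {E : banachLatticeType R}.
Implicit Types (x y z u v w : E) (f mu nu : E -> R).

Definition positive_functional f := scalar f /\ forall x, 0 <= x -> 0 <= f x.

Lemma positive_mono f x y : positive_functional f -> x <= y -> f x <= f y.
Proof.
by move=> [sf fp] xy; rewrite -subr_ge0 -(scalarB sf) fp// le_sub0.
Qed.

Lemma positive_labs f x : positive_functional f -> `|f x| <= f (labs x).
Proof.
move=> pf; rewrite ler_norml lerNl -(scalarN pf.1).
by rewrite !positive_mono// ?labs_ge ?labs_geN.
Qed.

(** Hahn-Banach for the norm of the positive part. This vanishes at [- y] for [y >= 0], which makes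
    the dominated functional positive. *)
Lemma norming_positive_functional x : exists f : E -> R,
  [/\ positive_functional f, bounded_functional f 1 & f x = `|lpos x|].
Proof.
have [|f [sf fp fx]] := @hahn_banach R E (fun x => `|lpos x|) x.
  split=> [y z|k y k0].
    apply: le_trans (ler_normD _ _); apply: norm_le0; first exact: lpos_ge0.
    exact: lposD_le.
  by rewrite lposZ// normrZ ger0_norm.
have fle y : f y <= `|y| by apply: le_trans (fp y) (norm_lpos y).
exists f; split=> //; split=> // y.
  move=> y0; rewrite -[f y]opprK -(scalarN sf) oppr_ge0; apply: (le_trans (fp _)).
  suff -> : lpos (- y) = 0 by rewrite normr0.
  by apply/le_anti; rewrite lpos_ge0 lpos_le lexx le_oppr0 y0.
rewrite mul1r ler_norml fle andbT.
by rewrite lerNl -scalarN// -[leRHS]normrN fle.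
Qed.

Lemma cone_extension (m : E -> R) :
  (forall x y, 0 <= x -> 0 <= y -> m (x + y) = m x + m y) ->
  (forall k x, 0 <= k -> 0 <= x -> m (k *: x) = k * m x) ->
  exists2 f, scalar f & forall x, 0 <= x -> f x = m x.
Proof.
move=> mD mZ; pose f x := m (lpos x) - m (lpos (- x)).
have fB (a b : E) : 0 <= a -> 0 <= b -> f (a - b) = m a - m b.
  move=> a0 b0; apply/eqP; rewrite subr_eq addrAC eq_sym subr_eq; apply/eqP.
  rewrite -!mD ?lpos_ge0//; congr m.
  by rewrite -[lpos (a - b)](subrK (lpos (- (a - b)))) lposB addrAC subrK.
exists f => [k x y|x x0]; last first.
  have m0 : m 0 = 0 by rewrite -(scale0r (0 : E)) mZ// mul0r.
  by rewrite -{1}(subr0 x) fB// m0 subr0.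
have fN (z : E) : f (- z) = - f z by rewrite /f opprK opprB.
have fZ l (z : E) : 0 <= l -> f (l *: z) = l * f z.
  by move=> l0; rewrite /f -scalerN !lposZ// !mZ ?lpos_ge0// mulrBr.
have fD (z t : E) : f (z + t) = f z + f t.
  rewrite -{1}(lposB z) -{1}(lposB t) addrACA -opprD fB ?le_add0 ?lpos_ge0//.
  by rewrite !mD ?lpos_ge0// /f opprD addrACA.
rewrite fD; congr (_ + _); have [k0|k0] := leP 0 k; first exact: fZ.
by rewrite -[k]opprK scaleNr fN fZ ?mulNr// oppr_ge0 ltW.
Qed.

(** The Riesz-Kantorovich formula: [nu] is the modulus of [f] in the dual lattice, and
    [riesz_decomp] gives additivity on the cone. *)
Lemma modulus f M : bounded_functional f M -> exists nu,
  [/\ positive_functional nu, bounded_functional nu M,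
      forall x y, labs y <= x -> f y <= nu x &
      forall x r, 0 <= x -> (forall y, labs y <= x -> f y <= r) -> nu x <= r].
Proof.
move=> [sf fM].
pose S x := [set f y | y in [set y | labs y <= x]].
pose m x := sup (S x).
have fle x y : labs y <= x -> f y <= `|M| * `|x|.
  move=> yx; apply: (le_trans (ler_norm _)); apply: (le_trans (fM y)).
  apply: (@le_trans _ _ (`|M| * `|y|)); first by rewrite ler_wpM2r// ler_norm.
  by rewrite ler_wpM2l// norm_le_pos.
have supS x : 0 <= x -> has_sup (S x).
  move=> x0; split; first by exists (f 0), 0; rewrite //= labs0.
  by exists (`|M| * `|x|) => _ [y yx <-]; exact: fle.
have ubm x y : labs y <= x -> f y <= m x.
  move=> yx; have x0 := le_trans (labs_ge0 y) yx.
  by apply: sup_upper_bound; [exact: supS|exists y].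
have lem x r : 0 <= x -> (forall y, labs y <= x -> f y <= r) -> m x <= r.
  move=> x0 h; apply: ge_sup; first exact: (supS x x0).1.
  by move=> _ [y yx <-]; exact: h.
have mD x y : 0 <= x -> 0 <= y -> m (x + y) = m x + m y.
  move=> x0 y0; apply/le_anti/andP; split.
    apply: lem; first exact: le_add0.
    move=> z /(riesz_decomp x0 y0)[z1 [z2 [-> z1x z2y]]].
    by rewrite scalarD// lerD// ubm.
  rewrite -lerBrDr; apply/lem => // z zx; rewrite lerBrDr addrC -lerBrDr.
  apply/lem => // t ty; rewrite lerBrDr -scalarD// ubm//.
  by apply: (le_trans (labsD _ _)); rewrite [x + y]addrC le_add.
have m0 x : 0 <= x -> 0 <= m x.
  by move=> x0; rewrite -(scalar0 sf) ubm// labs0.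
have mZ k x : 0 <= k -> 0 <= x -> m (k *: x) = k * m x.
  rewrite le_eqVlt => /predU1P[<- x0|k0 x0].
    rewrite scale0r mul0r; apply/le_anti; rewrite m0// andbT lem// => y.
    by move=> y0; rewrite (le_trans (fle _ _ y0))// normr0 mulr0.
  apply/le_anti/andP; split.
    apply: lem; first by rewrite scale_ge0// ltW.
    move=> y yx; rewrite -ler_pdivrMl// -(scalarZ sf) ubm//.
    rewrite labsZ gtr0_norm ?invr_gt0// -(le_scale_pos _ _ k0) scalerA divff ?gt_eqF//.
    by rewrite scale1r.
  rewrite -ler_pdivlMl//; apply: lem => // y yx; rewrite ler_pdivlMl//.
  by rewrite -(scalarZ sf) ubm// labsZ gtr0_norm// le_scale// ltW.
have [nu snu nuE] := cone_extension mD mZ.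
have pnu : positive_functional nu by split=> // x x0; rewrite nuE// m0.
exists nu; split=> //.
- split=> // x; apply: (le_trans (positive_labs x pnu)).
  rewrite nuE ?labs_ge0//; apply: lem => [|y yx]; first exact: labs_ge0.
  apply: (le_trans (ler_norm _)); apply: (le_trans (fM y)).
  (* With [M < 0] the bound on [f] forces the norms of [x] and [y] to vanish. *)
  have [|M0] := ltP M 0; last by rewrite ler_wpM2l// -(norm_labs x) norm_le_pos.
  move=> M0; have := le_trans (normr_ge0 _) (fM x).
  rewrite nmulr_rge0// normr_le0 => /eqP ?; subst x.
  have := le_trans (normr_ge0 _) (fM y).
  by rewrite nmulr_rge0// normr_le0 => /eqP->.
- by move=> x y yx; rewrite nuE ?ubm// (le_trans (labs_ge0 y)).
- by move=> x r x0 h; rewrite nuE// lem.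
Qed.

Lemma AM_truncation mu M (C e : R) : AM_space E -> positive_functional mu ->
  bounded_functional mu M -> 0 <= C -> 0 < e ->
  exists w, [/\ 0 <= w, `|w| <= C &
    forall x, `|x| <= C -> mu (lpos (labs x - w)) <= e].
Proof.
move=> AM pmu [smu muM] C0 e0.
pose S := [set mu w | w in [set w : E | 0 <= w /\ `|w| <= C]].
have supS : has_sup S.
  split; first by exists (mu 0), 0; rewrite //= normr0.
  exists (`|M| * C) => _ [w [w0 wC] <-]; apply: (le_trans (ler_norm _)).
  apply: (le_trans (muM w)); apply: (@le_trans _ _ (`|M| * `|w|)).
    by rewrite ler_wpM2r// ler_norm.
  by rewrite ler_wpM2l.
have [_ [w [w0 wC] <-] hw] := sup_adherent e0 supS.
exists w; split=> // x xC.
have -> : lpos (labs x - w) = labs x \join w - w by rewrite joinDr subrr.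
rewrite scalarB// lerBlDr; apply: (@le_trans _ _ (sup S)); last by lra.
apply: sup_upper_bound => //; exists (labs x \join w) => //; split.
  by rewrite lexUl// labs_ge0.
by rewrite AM ?labs_ge0// norm_labs ge_max xC.
Qed.

Lemma meet_lpos x u : x = x \meet u + lpos (x - u).
Proof.
have -> : lpos (x - u) = x \join u - u by rewrite joinDr subrr.
by rewrite addrA [_ + (x \join u)]addrC joinD_meet addrK.
Qed.

(** Common reduction for un- and uaw-convergence: the part of [labs (x i)] above a truncation level
    is uniformly small, and the hypothesis controls the part below it. *)
Lemma AM_functional_cvg0 (I : Type) (F : set_system I) (x : I -> E) f M (C : R) :
  AM_space E -> Filter F -> bounded_functional f M -> (forall i, `|x i| <= C) ->
  (forall nu, positive_functional nu -> bounded_functional nu M ->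
    forall u, 0 <= u -> nu (labs (x i) \meet u) @[i --> F] --> (0 : R)) ->
  f (x i) @[i --> F] --> (0 : R).
Proof.
move=> AM FF fM xC h; have [nu [pnu nuM fnu _]] := modulus fM.
apply/cvgrPdist_le => e e0.
(* A negative [C] leaves no index [i], and the convergence is vacuous. *)
have [[C0|nC]|] := pselect (0 <= C \/ ~ (0 <= C)); last first.
- by move=> H; exfalso; apply: H; exact: EM.
- by apply: nearW => i; exfalso; apply: nC; exact: le_trans (xC i).
have e2 : 0 < e / 2 by rewrite divr_gt0.
have [w [w0 wC hw]] := AM_truncation AM pnu nuM C0 e2.
have /cvgrPdist_le/(_ _ e2) := h nu pnu nuM w w0.
apply: filterS => i; rewrite !sub0r !normrN => hi.
apply: (@le_trans _ _ (nu (labs (x i)))).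
  rewrite ler_norml fnu// andbT lerNl -(scalarN fM.1).
  by rewrite fnu// labsN.
rewrite (meet_lpos (labs (x i)) w) (scalarD pnu.1).
have := hw _ (xC i); have := le_trans (ler_norm _) hi; lra.
Qed.

End positive_functionals.

(** * The order bidual *)

Lemma nat_gt (R : realType) (C : R) : exists n : nat, C < n%:R.
Proof. by exists (Num.truncn C).+1; exact: truncnS_gt. Qed.

Section order_dual_facts.
Context {R : realType} {E : banachLatticeType R}.
Implicit Types (x y z u v w : E) (f mu nu : E -> R).
Local Notation le := (<=%R : rel E).
Local Notation Edual := (order_dual le).
Local Notation Ebidual := (order_dual (@order_dual_le R E le)).

Lemma labs_itv_le x a b : a <= x -> x <= b -> labs x <= labs a + labs b.
Proof.
move=> ax xb; rewrite labs_le; apply/andP; split.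
  apply: (le_trans xb); apply: (le_trans (labs_ge _)).
  by rewrite le_addl// labs_ge0.
apply: (@le_trans _ _ (- a)); first by rewrite le_oppr2.
by apply: (le_trans (labs_geN _)); rewrite le_addr// labs_ge0.
Qed.

Lemma bounded_functional_order_dual f M : bounded_functional f M ->
  (f : E -> R^o) \in order_dual_pred le.
Proof.
move=> [sf fM]; apply/asboolP; split=> // A [a [b abA]].
exists (`|M| * `|labs a + labs b|); split; first exact: num_real.
move=> r ltr _ [x Ax <-]; apply: le_trans (ltW ltr).
have /andP[ax xb] := abA x Ax.
apply: (le_trans (fM x)); apply: (@le_trans _ _ (`|M| * `|x|)).
  by rewrite ler_wpM2r// ler_norm.
by rewrite ler_wpM2l// norm_le_pos// labs_itv_le.
Qed.

Lemma order_dual_scalar (f : Edual) : scalar (f : E -> R).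
Proof. by have /asboolP[] := valP f. Qed.

(** If [f] exceeded [4 ^+ n] in modulus at points [x n] of the unit ball, then by [majorant] the
    [2 ^- n *: x n] would lie in one order interval, where [f] would exceed every [2 ^+ n]. *)
Lemma order_dual_bounded (f : Edual) :
  exists M, bounded_functional (f : E -> R) M.
Proof.
have /asboolP[sf bf] := valP f.
suff [M hM] : exists M : R, forall x, `|x| <= 1 -> `|(f x : R)| <= M.
  exists M; split=> // x; have [->|x0] := eqVneq x 0.
    by rewrite (scalar0 sf) !normr0 mulr0.
  have nx : 0 < `|x| by rewrite normr_gt0.
  rewrite -ler_pdivrMr//; have := hM (`|x|^-1 *: x).
  rewrite normrZ normfV normr_id mulVf ?normr_eq0// => /(_ (lexx _)).
  by rewrite (scalarZ sf) normrM normfV normr_id mulrC.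
apply: contrapT => unb.
have h n : exists x, `|x| <= 1 /\ 4 ^+ n < `|(f x : R)|.
  apply: contrapT => h; apply: unb; exists (4 ^+ n) => x x1; rewrite leNgt.
  by apply/negP => ?; apply: h; exists x.
have [x xP] := boolp.choice h.
have [|n|v v0 hv] := @majorant R E (fun n => labs (x n)) 1.
- by move=> n; exact: labs_ge0.
- by rewrite norm_labs (xP n).1.
have [|M [_ hM]] := bf [set y | labs y <= v].
  exists (- v), v => y /=; rewrite labs_le => /andP[-> yv].
  by rewrite le_oppl yv.
pose M1 := `|M| + 1.
have M1P y : labs y <= v -> `|(f y : R)| <= M1.
  move=> yv; apply: (hM M1); first by rewrite (le_lt_trans (ler_norm _))// ltrDl.
  by exists y.
have M10 : 0 <= M1 by rewrite addr_ge0.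
have hk n : 2 ^+ n <= M1.
  have p0 : 0 < 2 ^+ n :> R by rewrite exprn_gt0.
  have := M1P (2 ^- n *: x n).
  rewrite labsZ normfV (gtr0_norm p0) -(le_scale_pos _ _ p0) scalerA.
  rewrite divff ?gt_eqF// scale1r => /(_ (hv n)).
  rewrite (scalarZ sf) normrM normfV (gtr0_norm p0) => /(le_trans _); apply.
  rewrite ler_pdivlMl// -exprMn -natrM ltW//; exact: (xP n).2.
have [n Mn] := nat_gt M1.
have : n%:R <= M1 by apply: (le_trans _ (hk n)); rewrite -natrX ler_nat ltnW// ltn_expl.
by rewrite leNgt Mn.
Qed.

Lemma order_dual_le0P (f : Edual) :
  order_dual_le 0 f <-> positive_functional (f : E -> R).
Proof.
split=> [/asboolP h|[_ h]]; last by apply/asboolP => x; exact: h.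
by split; [exact: order_dual_scalar|move=> x; exact: h].
Qed.

(* The bounds are only tested on positive functionals; a general one is a
   difference of two by [modulus]. *)
Lemma b_order_bounded_norm_bounded (A : set E) : b_order_bounded A ->
  exists C : R, forall x, A x -> `|x| <= C.
Proof.
move=> [Phi [Psi hA]]; apply: contrapT => unb.
have h n : exists x, A x /\ n%:R < `|x|.
  apply: contrapT => h; apply: unb; exists n%:R => x Ax; rewrite leNgt.
  by apply/negP => ?; apply: h; exists x.
have [x xP] := boolp.choice h.
have [|C hC] := @weakly_bounded R E x; last first.
  have [n Cn] := nat_gt C; have := hC n; rewrite leNgt => /negP; apply.
  exact: lt_trans Cn (xP _).2.
have pos_bounded f M : positive_functional f -> bounded_functional f M ->
    exists C : R, forall n, `|f (x n)| <= C.
  move=> pf fM; pose F : Edual := OrderDual (bounded_functional_order_dual fM).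
  have F0 : order_dual_le 0 F by exact/order_dual_le0P.
  exists (`|Phi F| + `|Psi F|) => n.
  have [Phix xPsi] : (Phi F : R) <= f (x n) /\ f (x n) <= (Psi F : R).
    have : [set order_bidual_eval z | z in A] (order_bidual_eval (x n)).
      by exists (x n) => //; exact: (xP n).1.
    by move=> /hA/andP[/asboolP/(_ F F0) ? /asboolP/(_ F F0)].
  rewrite ler_norml; apply/andP; split.
    have := ler_norm (- Phi F : R); rewrite normrN; have := normr_ge0 (Psi F : R); lra.
  have := ler_norm (Psi F : R); have := normr_ge0 (Phi F : R); lra.
move=> f M fM; have [nu [pnu nuM fnu _]] := modulus fM.
have [C1 hC1] := pos_bounded nu M pnu nuM.
have [||C2 hC2] := pos_bounded (fun y => nu y - f y) (M + M).
- split=> [k y z|y y0]; first by rewrite nuM.1 fM.1; ring.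
  by rewrite subr_ge0 fnu// labs_pos.
- split=> [k y z|y]; first by rewrite nuM.1 fM.1; ring.
  by rewrite mulrDl (le_trans (ler_normB _ _))// lerD// ?nuM.2 ?fM.2.
exists (C1 + C2) => n; rewrite -[f (x n)](subKr (nu (x n))).
by rewrite (le_trans (ler_normB _ _))// lerD.
Qed.

(* The upper bound is the limit along an ultrafilter containing the tails of the
   positive unit ball, which is directed upwards. *)
Lemma AM_ball_b_order_bounded : AM_space E ->
  b_order_bounded [set x : E | `|x| <= 1].
Proof.
move=> AM.
pose G0 : set_system E := [set S | exists2 a : E, 0 <= a /\ `|a| <= 1 &
  forall x, a <= x -> `|x| <= 1 -> S x].
have G0F : ProperFilter G0.
  apply: Build_ProperFilter_ex.
    by move=> S [a [a0 a1] aS]; exists a; exact: aS.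
  split.
  - by exists 0; rewrite ?normr0.
  - move=> S T [a [a0 a1] aS] [b [b0 b1] bT]; exists (a \join b).
      by rewrite lexUl// AM// ge_max a1.
    move=> x; rewrite leUx => /andP[ax bx] x1.
    by split; [exact: aS|exact: bT].
  - move=> S T ST [a ha aS]; exists a => // x ax x1; apply: ST; exact: aS.
have [U [UU G0U]] := ultraFilterLemma G0F.
have Uball : U [set x : E | `|x| <= 1].
  by apply: G0U; exists 0; rewrite ?normr0.
have h (f : Edual) : exists l : R, (f x : R) @[x --> U] --> l.
  have [M [sf fM]] := order_dual_bounded f.
  apply: (@ultra_cvg R E U (f : E -> R) `|M| UU); apply: filterS Uball => x /= x1.
  apply: (le_trans (fM x)); apply: (@le_trans _ _ (`|M| * `|x|)).
    by rewrite ler_wpM2r// ler_norm.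
  by rewrite ler_piMr.
have [Phi PhiP] := boolp.choice h.
have Phi_scalar : scalar (Phi : Edual -> R^o).
  move=> k f g.
  have h1 : ((k *: f + g : Edual) x : R) @[x --> U] --> k * Phi f + Phi g.
    by apply: cvgD; [apply: cvgMr|]; exact: PhiP.
  by rewrite -(cvg_lim _ h1)// -(cvg_lim _ (PhiP _)).
have Phi_ge (f : Edual) y : positive_functional (f : E -> R) -> `|y| <= 1 ->
    (f y : R) <= Phi f.
  move=> pf y1; rewrite -(cvg_lim _ (PhiP f))//.
  apply: limr_ge; first by apply/cvg_ex; exists (Phi f); exact: PhiP.
  apply: G0U; exists (labs y); first by rewrite labs_ge0 norm_labs.
  move=> x yx _; apply: (positive_mono pf); exact: le_trans (labs_ge y) yx.
have Phi_pos (f : Edual) : positive_functional (f : E -> R) -> 0 <= Phi f.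
  by move=> pf; rewrite -(scalar0 pf.1); apply: Phi_ge; rewrite ?normr0.
have sB := scalarB Phi_scalar.
have Phi_dual : (Phi : Edual -> R^o) \in order_dual_pred (@order_dual_le R E le).
  apply/asboolP; split=> // A [g [h' hA]].
  exists (`|Phi g| + `|Phi h' - Phi g|); split; first exact: num_real.
  move=> r ltr _ [f Af <-]; apply: le_trans (ltW ltr).
  have /andP[/asboolP gf /asboolP fh] := hA f Af.
  have p1 : 0 <= Phi f - Phi g.
    rewrite -sB; apply: Phi_pos; split; first exact: order_dual_scalar.
    by move=> x x0 /=; rewrite subr_ge0 gf.
  have p2 : 0 <= Phi h' - Phi f.
    rewrite -sB; apply: Phi_pos; split; first exact: order_dual_scalar.
    by move=> x x0 /=; rewrite subr_ge0 fh.
  have -> : Phi f = Phi g + (Phi f - Phi g) by rewrite addrC subrK.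
  apply: (le_trans (ler_normD _ _)); rewrite lerD2l ger0_norm//.
  apply: le_trans (ler_norm _); lra.
pose PhiD : Ebidual := OrderDual Phi_dual.
exists (- PhiD), PhiD => _ [x x1 <-].
apply/andP; split; apply/asboolP => f /order_dual_le0P pf.
  have := Phi_ge f (- x) pf; rewrite normrN (scalarN pf.1) => /(_ x1) hx.
  by rewrite /= lerNl.
by rewrite /=; exact: Phi_ge.
Qed.

End order_dual_facts.

(** * M-weakly compact operators *)

Lemma bounded_funP (R : realType) (V : normedModType R) (I : Type) (x : I -> V) :
  bounded_fun x <-> exists C : R, forall i, `|x i| <= C.
Proof.
split=> [[M [_ hM]]|[C hC]].
  by exists (M + 1) => i; apply: (hM (M + 1)); rewrite // ltrDl.
exists C; split; first exact: num_real.
by move=> M CM i _; exact: le_trans (hC i) (ltW CM).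
Qed.

Section M_weakly_compact_operators.
Context {R : realType} {E : banachLatticeType R} {X : completeNormedModType R}.
Implicit Types (x y z u v w : E) (f mu nu : E -> R).

Variables (T : {linear E -> X}) (K : R).
Hypotheses (K0 : 0 <= K) (TK : forall x, `|T x| <= K * `|x|).
Hypothesis (MT : M_weakly_compact T).

Definition solid_norm x : R := sup [set `|T z| | z in [set z | labs z <= x]].
Local Notation q := solid_norm.

Let q_has_sup x : 0 <= x -> has_sup [set `|T z| | z in [set z | labs z <= x]].
Proof.
move=> x0; split; first by exists `|T 0|, 0; rewrite //= labs0.
exists (K * `|x|) => _ [z zx <-]; apply: (le_trans (TK z)).
by rewrite ler_wpM2l// norm_le_pos.
Qed.

Lemma solid_norm_ub x z : labs z <= x -> `|T z| <= q x.
Proof.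
move=> zx; apply: sup_upper_bound; last by exists z.
exact/q_has_sup/(le_trans (labs_ge0 z)).
Qed.

Lemma solid_norm_le x (r : R) : 0 <= x -> (forall z, labs z <= x -> `|T z| <= r) ->
  q x <= r.
Proof.
move=> x0 h; apply: ge_sup; first exact: (q_has_sup x0).1.
by move=> _ [z zx <-]; exact: h.
Qed.

Lemma solid_norm_ge0 x : 0 <= x -> 0 <= q x.
Proof. by move=> x0; rewrite (le_trans (normr_ge0 (T 0)))// solid_norm_ub// labs0. Qed.

Lemma solid_norm_mono x y : 0 <= x -> x <= y -> q x <= q y.
Proof.
by move=> x0 xy; apply: solid_norm_le => // z zx; rewrite solid_norm_ub// (le_trans zx).
Qed.

Lemma solid_normD x y : 0 <= x -> 0 <= y -> q (x + y) <= q x + q y.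
Proof.
move=> x0 y0; apply: solid_norm_le; first exact: le_add0.
move=> z /(riesz_decomp x0 y0)[z1 [z2 [-> z1x z2y]]]; rewrite linearD.
by apply: (le_trans (ler_normD _ _)); rewrite lerD// solid_norm_ub.
Qed.

Lemma solid_norm_sum (I : Type) (r : seq I) (P : pred I) (x : I -> E) :
  (forall i, 0 <= x i) ->
  q (\sum_(i <- r | P i) x i) <= \sum_(i <- r | P i) q (x i).
Proof.
move=> x0; have q0 : q 0 <= 0.
  apply: solid_norm_le => // z z0; apply: (le_trans (TK z)).
  by rewrite (_ : `|z| = 0) ?mulr0//; apply/le_anti; rewrite normr_ge0 -(normr0 E) norm_le_pos.
suff : 0 <= \sum_(i <- r | P i) x i /\
    q (\sum_(i <- r | P i) x i) <= \sum_(i <- r | P i) q (x i) by case.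
apply: (big_ind2 (fun a b => 0 <= a /\ q a <= b)) => //.
  move=> a a' b b' [a0 aa'] [b0 bb']; split; first exact: le_add0.
  by apply: (le_trans (solid_normD _ _)) => //; rewrite lerD.
Qed.

Lemma solid_normZ k x : 0 <= k -> 0 <= x -> q (k *: x) <= k * q x.
Proof.
rewrite le_eqVlt => /predU1P[<- x0|k0 x0].
  (* The empty sum gives [q 0 <= 0]. *)
  have := @solid_norm_sum unit [::] predT (fun=> x) (fun=> x0).
  by rewrite !big_nil scale0r mul0r.
apply: solid_norm_le; first by rewrite scale_ge0// ltW.
move=> z zx; rewrite -ler_pdivrMl// -[k^-1]gtr0_norm ?invr_gt0// -normrZ -linearZ/=.
rewrite solid_norm_ub// labsZ gtr0_norm ?invr_gt0// -(le_scale_pos _ _ k0) scalerA.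
by rewrite divff ?gt_eqF// scale1r.
Qed.

(** Elements that attain [q (z n)] up to a factor [2] inherit disjointness from the [z n], so [MT]
    applies to them. *)
Lemma solid_norm_disjoint (z : nat -> E) (C : R) : (forall n, 0 <= z n) ->
  (forall n, `|z n| <= C) -> (forall n m, n != m -> z n \meet z m = 0) ->
  q (z n) @[n --> \oo] --> (0 : R).
Proof.
move=> z0 zC dz.
have h n : exists y, labs y <= z n /\ q (z n) <= 2 * `|T y|.
  have := solid_norm_ge0 (z0 n); rewrite le_eqVlt => /predU1P[q0|q0].
    by exists 0; rewrite labs0 -q0 mulr_ge0.
  have [_ [y yz <-]] := sup_adherent (divr_gt0 q0 (ltr0n _ 2)) (q_has_sup (z0 n)).
  by rewrite -/(q (z n)) => hy; exists y; split=> //; lra.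
have [y yP] := boolp.choice h.
have /MT Ty0 : bounded_fun y.
  apply/bounded_funP; exists C => n; apply: le_trans (zC n).
  by rewrite norm_le_pos// (yP n).1.
have {}Ty0 : `|T (y n)| @[n --> \oo] --> (0 : R).
  apply: Ty0 => n m nm.
  apply: (meet_disj_le (labs_ge0 _) (labs_ge0 _) (yP n).1 (yP m).1).
  exact: dz.
apply: (@squeeze_cvgr _ _ _ _ (cst 0) (fun n => 2 * `|T (y n)|)).
- by apply: nearW => n; rewrite solid_norm_ge0// (yP n).2.
- exact: cvg_cst.
- by rewrite -(mulr0 2); apply: cvgMr.
Qed.

(* For a fixed level [t] the crossings of [t] by the intervals [p n, r n] are
   pairwise disjoint. *)
Lemma solid_norm_chain (p r : nat -> E) w :
  (forall n, 0 <= p n) -> (forall n, p n <= r n) -> (forall n, r n <= p n.+1) ->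
  (forall n, r n <= w) -> q (r n - p n) @[n --> \oo] --> (0 : R).
Proof.
move=> p0 pr rp rw; have w0 : 0 <= w by exact: le_trans (le_trans (p0 0%N) (pr 0%N)) (rw 0%N).
have pp n m : (n <= m)%N -> p n <= p m.
  move=> /subnK <-; elim: (m - n)%N => // k IH; apply: (le_trans IH).
  exact: le_trans (pr _) (rp _).
pose d t n := lpos (t - p n) \meet lpos (r n - t).
have dd t n m : (n < m)%N -> d t n \meet d t m = 0.
  move=> nm; apply: (@meet_disj_le _ _ (lpos (p m - t)) (lpos (- (p m - t)))).
  - by rewrite meet_ge0 ?lpos_ge0.
  - by rewrite meet_ge0 ?lpos_ge0.
  - apply: (le_trans (leIr _ _)); apply: lpos_mono; rewrite le_add2r.
    exact: le_trans (rp n) (pp _ _ nm).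
  - by apply: (le_trans (leIl _ _)); rewrite opprB.
  - exact: lpos_disj.
have d0 t n : 0 <= d t n by rewrite meet_ge0 ?lpos_ge0.
have qd t : q (d t n) @[n --> \oo] --> (0 : R).
  apply: (@solid_norm_disjoint _ `|t|) => // [n|n m].
    apply: norm_le; rewrite labs_pos//; apply: (le_trans (leIl _ _)).
    apply: (@le_trans _ _ (lpos t)); last exact: lpos_labs.
    by apply: lpos_mono; rewrite le_subr le_addr.
  by case: ltngtP => // nm _; [exact: dd|rewrite meetC; exact: dd].
apply/cvgrPdist_le => eps eps0.
(* The mesh [w / N] costs [2 * q w / N], at most [eps / 2]; the crossings account for the other
   half. *)
have [N hN] := nat_gt (4 * q w / eps).
have N0 : 0 < N%:R :> R.
  apply: le_lt_trans hN; rewrite divr_ge0 ?(ltW eps0)// mulr_ge0// solid_norm_ge0//.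
pose e := N%:R^-1 *: w.
have e0 : 0 <= e by rewrite scale_ge0// invr_ge0 ltW.
pose D n := \sum_(j < N.+1) (q (d (j%:R *: e) n) + q (d (- (j%:R *: e)) n)).
have D0 : D n @[n --> \oo] --> (0 : R).
  rewrite /D; elim: N.+1 => [|k IH].
    under eq_fun do rewrite big_ord0; exact: cvg_cst.
  under eq_fun do rewrite big_ord_recr/=.
  have h : \sum_(j < k) (q (d (j%:R *: e) n) + q (d (- (j%:R *: e)) n)) +
      (q (d (k%:R *: e) n) + q (d (- (k%:R *: e)) n)) @[n --> \oo] --> 0 + (0 + 0 : R).
    by apply: cvgD; [exact: IH|apply: cvgD; exact: qd].
  by move: h; rewrite !addr0; apply.
have qle n : q (r n - p n) <= 2 * D n + 2 * (N%:R^-1 * q w).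
  pose m := 2^-1 *: (p n + r n); pose g := 2^-1 *: (r n - p n).
  have g0 : 0 <= g by rewrite scale_ge0 ?invr_ge0// le_sub0.
  have -> : r n - p n = 2 *: g by rewrite scalerA divff ?pnatr_eq0// scale1r.
  have crE t : crossing m g t = d t n.
    by rewrite /crossing midpointB midpointD.
  (* The grid reaches far enough: [0 <= m <= w = N%:R *: e]. *)
  have mw : lpos (labs m - N%:R *: e) = 0.
    apply/le_anti; rewrite lpos_ge0 lpos_le lexx le_subr add0r !andbT.
    rewrite scalerA divff ?gt_eqF// scale1r labs_pos; last first.
      by rewrite scale_ge0 ?invr_ge0// le_add0// (le_trans (p0 n)).
    rewrite -[w](midpointD w) subrr scaler0 addr0 le_scale ?invr_ge0//.
    by apply: le_add; rewrite // (le_trans (pr n)).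
  have := crossing_grid m g N e0; rewrite mw addr0 => gle.
  have S0 : forall j, 0 <= d (j%:R *: e) n + d (- (j%:R *: e)) n by move=> j; exact: le_add0.
  have : q g <= D n + N%:R^-1 * q w.
    apply: (le_trans (solid_norm_mono g0 gle)).
    apply: (le_trans (solid_normD _ e0)).
      by apply: le_sum0 => j _; rewrite !crE.
    apply: lerD; last by rewrite solid_normZ// invr_ge0 ltW.
    apply: (le_trans (solid_norm_sum _ _ _)) => [j|].
      by rewrite !crE.
    by apply: ler_sum => j _; rewrite !crE solid_normD.
  have := solid_normZ (ler0n R 2) g0; lra.
have /cvgrPdist_le/(_ (eps / 4)) := D0.
rewrite divr_gt0// => /(_ isT); apply: filterS => n.
rewrite !sub0r !normrN => hD.
rewrite ger0_norm ?solid_norm_ge0 ?le_sub0//; apply: (le_trans (qle n)).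
have h2 : N%:R^-1 * q w <= eps / 4.
  rewrite ler_pdivrMl//; move: hN; rewrite ltr_pdivrMr// => /ltW; lra.
have := ler_norm (D n); lra.
Qed.

(** A Cauchy property for [q]: otherwise successive differences along a subsequence would form a
    chain on which [q] stays above [e]. *)
Lemma solid_norm_increasing (s : nat -> E) w (e : R) : 0 < e ->
  (forall n, 0 <= s n) -> (forall n, s n <= s n.+1) -> (forall n, s n <= w) ->
  exists n, forall m, (n <= m)%N -> q (s m - s n) <= e.
Proof.
move=> e0 s0 ss sw; apply: contrapT => H.
have mono n m : (n <= m)%N -> s n <= s m.
  move=> /subnK <-; elim: (m - n)%N => // k IH; exact: le_trans IH (ss _).
have h n : exists m, (n <= m)%N /\ e < q (s m - s n).
  apply: contrapT => h; apply: H; exists n => m nm; rewrite leNgt.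
  by apply/negP => ?; apply: h; exists m.
have [phi hphi] := boolp.choice h.
pose k i := iter i phi 0%N.
have : q (s (k i.+1) - s (k i)) @[i --> \oo] --> (0 : R).
  apply: (@solid_norm_chain (fun i => s (k i)) (fun i => s (k i.+1)) w) => // i.
  by apply: mono; exact: (hphi (k i)).1.
move=> /cvgrPdist_lt/(_ e e0)[i _ /(_ i (leqnn i))].
rewrite /= sub0r normrN => /(le_lt_trans (ler_norm _)).
by rewrite ltNge ltW// (hphi (k i)).2.
Qed.

Lemma solid_norm_decreasing (s : nat -> E) w (e : R) : 0 < e ->
  (forall n, 0 <= s n) -> (forall n, s n.+1 <= s n) -> (forall n, s n <= w) ->
  exists n, forall m, (n <= m)%N -> q (s n - s m) <= e.
Proof.
move=> e0 s0 ss sw.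
have [|n|n|n h] := @solid_norm_increasing (fun n => w - s n) w e e0.
- by move=> n; rewrite le_sub0.
- by rewrite le_add2l le_oppr2.
- by rewrite le_subr le_addr.
- exists n => m nm; have := h m nm.
  by rewrite opprB addrCA addrAC subrr add0r.
Qed.

(** If every [w] fails, choose counterexamples recursively, taking for [w] the multiple [c n] of the
    sum of the earlier ones. This is the pattern of [disjointification], and the resulting disjoint
    sequence satisfies [d <= q (y n) + 2 ^- n * q v], against [solid_norm_disjoint]. *)
Lemma solid_norm_truncation (d : R) : 0 < d -> exists2 w, 0 <= w &
  forall x, `|x| <= 1 -> q (lpos (labs x - w)) <= d.
Proof.
move=> d0; apply: contrapT => H.
have h w : exists x, 0 <= w -> `|x| <= 1 /\ d < q (lpos (labs x - w)).
  have [w0|nw0] := pselect (0 <= w); last by exists 0.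
  apply: contrapT => h; apply: H; exists w => // x x1; rewrite leNgt.
  by apply/negP => ?; apply: h; exists x.
have [phi hphi] := boolp.choice h.
pose c (n : nat) : R := 2 ^+ n * 2 ^+ n.
have c0 n : 0 <= c n by rewrite mulr_ge0// exprn_ge0.
pose fix S n : E := if n is n'.+1 then S n' + labs (phi (c n' *: S n')) else 0.
pose x n := labs (phi (c n *: S n)).
have SE n : S n = \sum_(i < n) x i.
  by elim: n => [|n IH]; rewrite ?big_ord0// big_ord_recr/= -IH.
have x0 n : 0 <= x n by exact: labs_ge0.
have S0 n : 0 <= S n by rewrite SE le_sum0.
have hx n := hphi (c n *: S n) (scale_ge0 (c0 n) (S0 n)).
have [|v v0 xv] := @majorant R E x 1 x0; first by move=> n; rewrite norm_labs (hx n).1.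
have := @disjointification R E x v x0 v0 xv.
set y := fun n => lpos _ => dy.
have qy : q (y n) @[n --> \oo] --> (0 : R).
  apply: (@solid_norm_disjoint _ 1) => // [n|n]; first exact: lpos_ge0.
  apply: (@le_trans _ _ `|x n|); last by rewrite norm_labs (hx n).1.
  apply: norm_le0; first exact: lpos_ge0.
  rewrite lpos_le x0 andbT le_subr.
  apply: (@le_trans _ _ (x n)); first by rewrite le_subr le_addr// scale_ge0// -SE.
  by rewrite le_addr// scale_ge0// invr_ge0 exprn_ge0.
have dle n : d <= q (y n) + 2 ^- n * q v.
  have p0 : 0 <= 2 ^- n :> R by rewrite invr_ge0 exprn_ge0.
  apply: (le_trans (ltW (hx n).2)).
  apply: (@le_trans _ _ (q (y n + 2 ^- n *: v))).
    apply: solid_norm_mono; first exact: lpos_ge0.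
    rewrite lpos_le le_add0 ?scale_ge0// ?lpos_ge0// andbT -le_subr.
    by rewrite /y -SE -/(x n) -/(c n); exact: lpos_ge.
  apply: (le_trans (solid_normD _ _)); rewrite ?lpos_ge0 ?scale_ge0//.
  by rewrite lerD2l solid_normZ.
have lim0 : q (y n) + 2 ^- n * q v @[n --> \oo] --> (0 : R).
  rewrite -[X in _ --> X]addr0; apply: cvgD => //.
  rewrite -(mul0r (q v)); apply: cvgMl.
  under eq_fun do rewrite -exprVn.
  by apply: cvg_expr; rewrite ger0_norm ?invr_ge0// invf_lt1// ltr1n.
have /cvgrPdist_lt/(_ d d0)[n _ /(_ n (leqnn n))] := lim0.
rewrite /= sub0r normrN => /(le_lt_trans (ler_norm _)).
by rewrite ltNge dle.
Qed.

Lemma functional_modulus (h : X -> R) : bounded_functional h 1 -> exists nu,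
  [/\ positive_functional nu, bounded_functional nu K,
      forall x, h (T x) <= nu (labs x) & forall x, 0 <= x -> nu x <= q x].
Proof.
move=> [sh h1].
have [|nu [pnu nuK nuh nule]] := @modulus R E (fun x => h (T x)) K.
  split=> [k x y|x]; first by rewrite linearP sh.
  by rewrite (le_trans (h1 _))// mul1r.
exists nu; split=> // [x|x x0]; first exact: nuh.
apply: nule => // y yx; apply: (le_trans (ler_norm _)); apply: (le_trans (h1 _)).
by rewrite mul1r solid_norm_ub.
Qed.

(* A uniform countable additivity argument. The joins of the [u k], [k >= n], form a
   chain, so up to small errors they are attained at a finite stage [t n]; the
   decreasing meets [S n] of the [t n] form a chain as well, hence [nu n (u n)] is
   close to [nu n (S m)], which is small for large [m]. *)
Lemma solid_norm_control (u : nat -> E) (nu : nat -> E -> R) w (e : R) : 0 < e ->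
  (forall n, 0 <= u n) -> (forall n, u n <= w) ->
  (forall n, positive_functional (nu n)) ->
  (forall n x, 0 <= x -> nu n x <= q x) ->
  (forall n m, (n < m)%N -> nu n (u m) <= 2 ^+ n * 2 ^- m) ->
  exists n, nu n (u n) <= e.
Proof.
move=> e0 u0 uw pnu nuq nuu.
pose J := block_join u.
have J0 n i : 0 <= J n i by exact: block_join_ge0.
have Jw n i : J n i <= w by exact: block_join_le.
have JS n i : J n i <= J n i.+1 by exact: leUl.
have p2 n : 0 < 2 ^- n :> R by rewrite invr_gt0 exprn_gt0.
pose d n : R := e / 8 * 2 ^- n.
have d0 n : 0 < d n by rewrite mulr_gt0// divr_gt0.
(* From stage [i n] on, the block join starting at [n] grows by at most [d n] in [q]. *)
have [i iP] := boolp.choice (fun n => solid_norm_increasing (d0 n) (J0 n) (JS n) (Jw n)).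
pose t n := J n (i n).
pose fix S n : E := if n is n'.+1 then S n' \meet t n else t 0%N.
have S0 n : 0 <= S n by elim: n => [|n IH]; rewrite /= ?lexI ?IH ?J0.
have Sw n : S n <= w by elim: n => [|n IH] /=; [exact: Jw|rewrite leIxl].
have St n : S n <= t n by case: n => [//|n] /=; exact: leIr.
have SS n : S n.+1 <= S n by exact: leIl.
have uS x n : x <= S n + \sum_(j < n.+1) lpos (x - t j).
  elim: n => [|n IH].
    by rewrite big_ord_recr big_ord0/= add0r addrC -le_subr lpos_ge.
  rewrite big_ord_recr/= meetDr lexI; apply/andP; split.
    by rewrite addrA (le_trans IH)// le_addr// lpos_ge0.
  apply: (@le_trans _ _ (t n.+1 + lpos (x - t n.+1))).
    by rewrite addrC -le_subr lpos_ge.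
  by rewrite le_add2l le_addl// le_sum0// => j _; exact: lpos_ge0.
(* [u n] belongs to every long enough block starting at [j <= n], so it exceeds [t j] by at most the
   growth of that block. *)
have qt n j : (j <= n)%N -> q (lpos (u n - t j)) <= d j.
  move=> jn; pose k := maxn (i j) (n - j).
  have ik : (i j <= k)%N by exact: leq_maxl.
  apply: le_trans (iP j k ik).
  have tJ : t j <= J j k.
    by rewrite /t -(subnK ik); elim: (k - i j)%N => // l IH; apply: (le_trans IH); exact: JS.
  apply: solid_norm_mono; first exact: lpos_ge0.
  rewrite lpos_le le_sub0 tJ andbT le_add2r.
  by rewrite -{1}(subnKC jn) block_join_mem// leq_maxr.
have sumd n : \sum_(j < n.+1) d j <= e / 4.
  suff -> : \sum_(j < n.+1) d j = e / 4 * (1 - 2 ^- n.+1).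
    rewrite ger_pMr ?divr_gt0//; have := p2 n.+1; lra.
  elim: n => [|n IH]; first by rewrite big_ord_recr big_ord0/= /d expr0 expr1; lra.
  by rewrite big_ord_recr/= IH /d !exprS !invfM; lra.
have nuJ n m k : (n < m)%N -> nu n (J m k) <= 2 ^+ n * 2 ^- m * (2 - 2 ^- k).
  move=> nm; elim: k => [|k IH].
    by rewrite /= expr0 (_ : 2 - 1^-1 = 1) ?mulr1 ?nuu// invr1; lra.
  rewrite /=; apply: (@le_trans _ _ (nu n (J m k) + nu n (u (m + k.+1)%N))).
    rewrite -(scalarD (pnu n).1); apply: (positive_mono (pnu n)).
    by rewrite leUx le_addr// le_addl.
  have := nuu n (m + k.+1)%N (leq_trans nm (leq_addr _ _)).
  rewrite exprD invfM.
  have e2 : 2 ^- k = 2 * 2 ^- k.+1 :> R.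
    by rewrite exprS invfM mulrA divff ?mul1r// pnatr_eq0.
  by move: IH; rewrite e2; lra.
have e4 : 0 < e / 4 by rewrite divr_gt0.
have [n hn] := solid_norm_decreasing e4 S0 SS Sw.
exists n.
(* By [nuJ], [nu n (t m)] is at most [2 ^+ n * 2 ^- m * 2], which a late [m] makes small. *)
have [m [nm hm]] : exists m, (n < m)%N /\ 2 ^+ n * 2 ^- m * 2 <= e / 4 :> R.
  have [k hk] := nat_gt (2 ^+ n * 2 / (e / 4)).
  exists (n.+1 + k)%N; split; first by rewrite leq_addr.
  rewrite ltr_pdivrMr// in hk.
  have hk2 : k%:R <= 2 ^+ (n.+1 + k) :> R.
    by rewrite -natrX ler_nat ltnW// (leq_trans (ltn_expl k (ltnSn 1)))// leq_exp2l// leq_addl.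
  rewrite mulrAC ler_pdivrMr ?exprn_gt0//; apply: (le_trans (ltW hk)).
  by rewrite mulrC ler_pM2l.
have h1 : nu n (u n) <= nu n (S n) + e / 4.
  apply: (@le_trans _ _ (nu n (S n + \sum_(j < n.+1) lpos (u n - t j)))).
    exact: positive_mono.
  have sp : 0 <= \sum_(j < n.+1) lpos (u n - t j).
    by apply: le_sum0 => j _; exact: lpos_ge0.
  rewrite (scalarD (pnu n).1) lerD2l; apply: (le_trans (nuq n _ sp)).
  apply: (le_trans (solid_norm_sum _ _ _)) => [j|]; first exact: lpos_ge0.
  by apply: le_trans (sumd n); apply: ler_sum => j _; rewrite qt// -ltnS.
have Snm : S m <= S n.
  rewrite -(subnK (ltnW nm)); elim: (m - n)%N => // k IH; apply: le_trans IH; exact: SS.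
have h2 : nu n (S n) <= nu n (S m) + e / 4.
  rewrite -lerBlDl -(scalarB (pnu n).1); apply: le_trans (hn m (ltnW nm)).
  by rewrite nuq// le_sub0.
have h3 : nu n (S m) <= e / 4.
  apply: (le_trans (positive_mono (pnu n) (St m))); apply: (le_trans (nuJ n m (i m) nm)).
  apply: le_trans hm; rewrite ler_pM2l ?mulr_gt0// ?exprn_gt0//.
  by rewrite gerBl ltW.
lra.
Qed.

(** If every [mu] fails, each one yields a [v] in the ball, small for [mu], and a [nu] below [q]
    with [nu (labs v) >= d]. The next functional is [2 * (mu + nu)]; the doubling gives
    [nu n (labs (v m)) <= 2 ^+ n * 2 ^- m] for [n < m], which [solid_norm_control] refutes after
    truncation. *)
Lemma M_weakly_compact_control (d : R) : 0 < d -> exists mu M,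
  [/\ positive_functional mu, bounded_functional mu M, 0 <= M &
      forall v, `|v| <= 1 -> mu (labs v) <= 1 -> `|T v| <= d].
Proof.
move=> d0; apply: contrapT => H.
pose good mu := positive_functional mu /\ exists2 M, 0 <= M & bounded_functional mu M.
have h mu : exists vn : E * (E -> R), good mu ->
    [/\ `|vn.1| <= 1, mu (labs vn.1) <= 1, good vn.2, d <= vn.2 (labs vn.1) &
        forall x, 0 <= x -> vn.2 x <= q x].
  have [gmu|ng] := pselect (good mu); last by exists (0, fun=> 0).
  apply: contrapT => h; apply: H; have [pmu [M M0 muM]] := gmu.
  exists mu, M; split=> // v v1 muv; rewrite leNgt; apply/negP => dv; apply: h.
  have [g g1 gT] := norming_functional (T v).
  have [nu [pnu nuK nug nuq]] := functional_modulus g1.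
  exists (v, nu) => _; split=> //=; first by split=> //; exists K.
  by apply: (le_trans (ltW dv)); rewrite -gT.
have [phi phiP] := boolp.choice h.
pose fix mu n : E -> R := if n is n'.+1 then
  fun x => 2 * (mu n' x + (phi (mu n')).2 x) else fun=> 0.
have gmu n : good (mu n).
  elim: n => [|n [[smu pmu] [M M0 muM]]].
    split; first by split=> // k x y; rewrite mulr0 addr0.
    exists 0 => //; split=> [k x y|x]; first by rewrite mulr0 addr0.
    by rewrite normr0 mul0r.
  have [_ _ [[snu pnu] [M' M'0 nuM']] _ _] :=
    phiP (mu n) (conj (conj smu pmu) (ex_intro2 _ _ M M0 muM)).
  split; first by split=> [k x y|x x0] /=; [rewrite smu snu; ring|
    rewrite mulr_ge0// addr_ge0 ?pmu ?pnu].
  exists (2 * (M + M')); first by rewrite mulr_ge0// addr_ge0.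
  split=> [k x y|x] /=; first by rewrite smu snu; ring.
  rewrite normrM ger0_norm// -mulrA ler_pM2l// mulrDl.
  by apply: (le_trans (ler_normD _ _)); rewrite lerD ?muM.2 ?nuM'.2.
pose v n := (phi (mu n)).1; pose nu n := (phi (mu n)).2.
have P n := phiP (mu n) (gmu n).
have pnu n : positive_functional (nu n) by have [_ _ []] := P n.
have nuq n x : 0 <= x -> nu n x <= q x by have [_ _ _ _] := P n; exact.
have munu n m x : 0 <= x -> (n < m)%N -> 2 ^+ m * nu n x <= 2 ^+ n * mu m x.
  move=> x0 /subnK <-; elim: (m - n.+1)%N => [|k IH].
    rewrite add0n /= exprS -/(nu n) mulrCA -mulrA ler_pM2l// ler_pM2l ?exprn_gt0//.
    by rewrite lerDr (gmu n).1.2.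
  rewrite addSn /= exprS -/(nu _).
  have : 0 <= 2 ^+ n * nu (k + n.+1)%N x.
    by rewrite mulr_ge0 ?exprn_ge0// (pnu _).2.
  move: IH; lra.
(* The excess over [w] contributes at most [d / 2] and the truncated part [d / 4], short of the
   required [d]. *)
have d2 : 0 < d / 2 by rewrite divr_gt0.
have d4 : 0 < d / 4 by rewrite divr_gt0.
have [w w0 hw] := solid_norm_truncation d2.
have [n|n|n|n x x0|n m nm|n] := @solid_norm_control (fun n => labs (v n) \meet w) nu w _ d4.
- by rewrite lexI labs_ge0.
- exact: leIr.
- exact: pnu.
- exact: nuq.
- have lm0 : 0 <= labs (v m) \meet w by rewrite lexI labs_ge0.
  rewrite ler_pdivlMr ?exprn_gt0// mulrC; apply: (le_trans (munu n m _ lm0 nm)).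
  rewrite ger_pMr ?exprn_gt0//; have [_ + _ _ _] := P m; apply: le_trans.
  by apply: (positive_mono (gmu m).1); exact: leIl.
apply/negP; rewrite -ltNge.
have [v1 _ _ dnu _] := P n.
move: dnu; rewrite -/(v n) -/(nu n) {1}(meet_lpos (labs (v n)) w) (scalarD (pnu n).1).
have := nuq n _ (lpos_ge0 (labs (v n) - w)); have := hw (v n) v1; lra.
Qed.

End M_weakly_compact_operators.

(** * Weakly null sequences in AM-spaces *)

Section AM_weak_sequences.
Context {R : realType} {E : banachLatticeType R}.
Hypothesis AM : AM_space E.
Implicit Types (y z u v w b : E) (f g mu nu : E -> R) (x : nat -> E).
Local Notation blocks x := (block_join (fun k : nat => labs (x k))).

(** Positive parts are taken because [y] and [z] will be signed elements, while the AM identity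
    concerns positive ones. *)
Lemma AM_lpos_join b y z (c : R) : c <= `|lpos (b \meet (y \join z))| ->
  c <= `|lpos (b \meet y)| \/ c <= `|lpos (b \meet z)|.
Proof.
move=> h; apply/orP; rewrite -le_max -AM ?lpos_ge0//; apply: (le_trans h).
apply: norm_le0; first exact: lpos_ge0.
rewrite lpos_le (lexUl _ (lpos_ge0 _)) andbT; apply: (le_trans (meet_join_le _ _ _)).
rewrite leUx; apply/andP; split; apply: (le_trans (lpos_ge _)).
  exact: leUl.
exact: leUr.
Qed.

Lemma AM_block_choice x n i b (c : R) : c <= `|lpos (b \meet blocks x n i)| ->
  exists k, (k <= i)%N /\ exists s : bool,
    c <= `|lpos (b \meet ((-1) ^+ s *: x (n + k)%N))|.
Proof.
have h k y : c <= `|lpos (b \meet labs (x k))| -> exists s : bool,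
    c <= `|lpos (b \meet ((-1) ^+ s *: x k))|.
  by move=> /AM_lpos_join[?|?]; [exists false; rewrite expr0 scale1r|
    exists true; rewrite expr1 scaleN1r].
elim: i => [|i IH] /=.
  by move=> /(h n 0)[s hs]; exists 0%N; split=> //; exists s; rewrite addn0.
move=> /AM_lpos_join[/IH[k [ki hk]]|/(h _ 0)[s hs]].
  by exists k; split=> //; exact: leqW.
by exists i.+1; split=> //; exists s.
Qed.

(* In an AM-space the norm of a join of positive elements is attained by one of
   them, so a meet of joins contains a meet of single elements of the same norm. *)
Lemma AM_blocks_functional x (n i : nat -> nat) (c : R) (P : nat -> E) :
  P 0%N = blocks x (n 0%N) (i 0%N) ->
  (forall j, P j.+1 = P j \meet blocks x (n j.+1) (i j.+1)) ->
  (forall j, 0 <= P j) -> (forall j, c <= `|P j|) ->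
  forall j, exists g, bounded_functional g 1 /\
    forall l, (l <= j)%N -> exists k, (k <= i l)%N /\ c <= `|g (x (n l + k)%N)|.
Proof.
move=> P0 PS Pge0 Pc j.
(* [b] is arbitrary so that the last block can be absorbed in it while the induction treats the
   earlier ones. *)
have h b : c <= `|lpos (b \meet P j)| -> exists2 b', c <= `|lpos b'| &
    b' <= b /\ forall l, (l <= j)%N -> exists k, (k <= i l)%N /\
      exists s : bool, b' <= (-1) ^+ s *: x (n l + k)%N.
  elim: j b => [|j IH] b.
    rewrite P0 => /AM_block_choice[k [ki [s hs]]].
    exists (b \meet ((-1) ^+ s *: x (n 0%N + k)%N)) => //; split; first exact: leIl.
    by move=> l; rewrite leqn0 => /eqP->; exists k; split=> //; exists s; exact: leIr.
  rewrite PS [P j \meet _]meetC meetA => /IH[b' b'c [b'b hb']].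
  have : c <= `|lpos (b' \meet blocks x (n j.+1) (i j.+1))|.
    rewrite (_ : b' \meet _ = b')//; apply/le_anti; rewrite leIl lexI lexx/=.
    by apply: (le_trans b'b); exact: leIr.
  move=> /AM_block_choice[k [ki [s hs]]].
  exists (b' \meet ((-1) ^+ s *: x (n j.+1 + k)%N)) => //; split.
    by apply: (le_trans (leIl _ _)); apply: (le_trans b'b); exact: leIl.
  move=> l; rewrite leq_eqVlt => /predU1P[->|].
    by exists k; split=> //; exists s; exact: leIr.
  rewrite ltnS => /hb'[k' [k'i [s' hs']]]; exists k'; split=> //; exists s'.
  exact: le_trans (leIl _ _) hs'.
have [|b bc [_ hb]] := h (P j).
  by rewrite meetxx lpos_pos.
(* Positivity of [g] carries its large value at [b] to every signed element above [b]. *)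
have [g [pg g1 gb]] := norming_positive_functional b.
exists g; split=> // l /hb[k [ki [s hs]]]; exists k; split=> //.
apply: (@le_trans _ _ (g ((-1) ^+ s *: x (n l + k)%N))).
  apply: (le_trans bc); rewrite -gb; exact: positive_mono hs.
rewrite (scalarZ pg.1); apply: (le_trans (ler_norm _)).
by rewrite normrM normrX normrN1 expr1n mul1r.
Qed.

(* If [mu (labs (x n))] does not tend to [0], disjoint blocks of joins of the
   [labs (x n)] almost realise the limit superior, so their finite meets have [mu]
   bounded below. A cluster point of the functionals of [AM_blocks_functional] is
   then bounded away from [0] at some [x n] in every block. *)
Lemma AM_weakly_null_labs (x : nat -> E) (C : R) mu M :
  (forall n, `|x n| <= C) ->
  (forall f M, bounded_functional f M -> f (x n) @[n --> \oo] --> (0 : R)) ->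
  positive_functional mu -> bounded_functional mu M -> 0 <= M ->
  mu (labs (x n)) @[n --> \oo] --> (0 : R).
Proof.
move=> xC xw pmu muM M0; apply/cvgrPdist_le => e e0; apply: contrapT => H.
have C0 : 0 <= C by exact: le_trans (xC 0%N).
pose J := blocks x.
have J0 n i : 0 <= J n i.
  by apply: block_join_ge0; exact: labs_ge0.
have JC n i : `|J n i| <= C.
  rewrite /J; elim: i => [|i IH] /=; first by rewrite norm_labs.
  by rewrite AM ?labs_ge0 ?ge_max ?IH ?norm_labs ?xC//; exact: J0.
have muJ n i : mu (J n i) <= M * C.
  apply: (le_trans (ler_norm _)); apply: (le_trans (muM.2 _)).
  by rewrite ler_wpM2l.
pose a n := sup [set mu (J n i) | i in [set: nat]].
have supJ n : has_sup [set mu (J n i) | i in [set: nat]].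
  by split; [exists (mu (J n 0%N)), 0%N|exists (M * C) => _ [i _ <-]].
have Ja n i : mu (J n i) <= a n by apply: sup_upper_bound => //; exists i.
have aJ n m i : (n <= m)%N -> mu (J m i) <= a n.
  move=> nm; apply: le_trans (Ja n (m + i - n)%N); apply: (positive_mono pmu).
  by apply: block_join_sub => //; rewrite subnKC// (leq_trans nm)// leq_addr.
have a_dec n m : (n <= m)%N -> a m <= a n.
  move=> nm; apply: ge_sup; first exact: (supJ m).1.
  by move=> _ [i _ <-]; exact: aJ.
have ae n : e <= a n.
  rewrite leNgt; apply/negP => an; apply: H; exists n => // m /= nm.
  rewrite sub0r normrN ger0_norm ?pmu.2 ?labs_ge0// ltW//.
  by apply: le_lt_trans an; exact: (aJ n m 0%N nm).
have infa : has_inf (range a).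
  by split; [exists (a 0%N), 0%N|exists e => _ [n _ <-]].
pose a0 := inf (range a).
have a0a n : a0 <= a n by apply: ge_inf; [exact: infa.2|exists n].
have ea0 : e <= a0 by apply: lb_le_inf; [exact: infa.1|move=> _ [n _ <-]].
pose d j : R := e / 8 * 2 ^- j.
have p2 j : 0 < 2 ^- j :> R by rewrite invr_gt0 exprn_gt0.
have d0 j : 0 < d j by rewrite mulr_gt0// divr_gt0.
have hN j : exists N, forall n, (N <= n)%N -> a n <= a0 + d j.
  have [_ [n _ <-] hn] := inf_adherent (d0 j) infa.
  by exists n => m nm; apply: (le_trans (a_dec _ _ nm)); exact: ltW.
have [N NP] := boolp.choice hN.
have hi (nj : nat * nat) : exists i, a nj.1 - d nj.2 <= mu (J nj.1 i).
  case: nj => n j /=; have [_ [i _ <-] hi] := sup_adherent (d0 j) (supJ n).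
  by exists i; exact: ltW.
have [i iP] := boolp.choice hi.
(* Each block starts strictly after the previous one ends, and late enough for its supremum to be
   within [d j] of [a0]. *)
pose n := fix n j : nat := if j is j'.+1 then
  maxn (N j) (n j' + i (n j', j')).+1 else N 0%N.
pose s j := J (n j) (i (n j, j)).
have nN j : (N j <= n j)%N by case: j => //= j; exact: leq_maxl.
have nn j : (n j + i (n j, j) < n j.+1)%N by rewrite /= leq_maxr.
have nj j : (j <= n j)%N.
  elim: j => // j IH; apply: leq_trans (nn j); rewrite ltnS.
  by rewrite (leq_trans IH)// leq_addr.
have mus j : a0 - d j <= mu (s j).
  by apply: le_trans (iP (n j, j)); rewrite lerD2r a0a.
have mussup j : mu (s j \join s j.+1) <= a0 + d j.
  apply: le_trans (NP j _ (nN j)).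
  have nnj : (n j <= n j.+1)%N by rewrite (leq_trans _ (nn j))// ltnW// ltnS leq_addr.
  apply: le_trans (Ja (n j) (n j.+1 + i (n j.+1, j.+1) - n j)%N).
  apply: (positive_mono pmu); rewrite leUx; apply/andP; split.
    apply: block_join_sub => //; rewrite subnKC; last first.
      by rewrite (leq_trans nnj)// leq_addr.
    by rewrite (leq_trans (ltnW (nn j)))// leq_addr.
  apply: block_join_sub => //; rewrite subnKC//.
  by rewrite (leq_trans nnj)// leq_addr.
pose P := fix P j : E := if j is j'.+1 then P j' \meet s j else s 0%N.
have P0 j : 0 <= P j by elim: j => [|j IH] /=; rewrite ?lexI ?IH J0.
have Ps j : P j <= s j by case: j => //= j; exact: leIr.
(* By modularity each meet costs at most [d j + d j.+1], since [a0] cancels; [3 / 8 * e * 2 ^- j] is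
   the sum of the losses still to come. *)
have muP j : e / 2 + 3 / 8 * e * 2 ^- j <= mu (P j).
  elim: j => [|j IH]; first by have := mus 0%N; rewrite /d expr0; lra.
  have h1 : mu (P j) + mu (s j.+1) = mu (P j \join s j.+1) + mu (P j.+1).
    by rewrite -!(scalarD pmu.1) joinD_meet.
  have h2 : mu (P j \join s j.+1) <= mu (s j \join s j.+1).
    by apply: (positive_mono pmu); rewrite leUx leUr lexUl.
  have := mus j.+1; have := mussup j; move: IH.
  rewrite /d !exprS !invfM; lra.
(* The norm bound on [mu] turns [e / 2 <= mu (P j)] into a lower bound for the norm of [P j]. *)
pose c := e / (2 * (M + 1)).
have M1 : 0 < M + 1 by rewrite ltr_wpDl.
have c0 : 0 < c by rewrite divr_gt0// mulr_gt0.
have Pc j : c <= `|P j|.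
  rewrite ler_pdivrMr ?mulr_gt0//.
  have h := le_trans (ler_norm _) (muM.2 (P j)).
  have : 0 <= 3 / 8 * e * 2 ^- j by rewrite !mulr_ge0 ?divr_ge0 ?(ltW e0) ?(ltW (p2 j)).
  have := normr_ge0 (P j); have := muP j; nra.
have [g gP] := boolp.choice (@AM_blocks_functional x n (fun j => i (n j, j)) c P erefl
  (fun=> erefl) P0 Pc).
have [U UU sU] := ultra_infty.
have [f f1 gf] := bounded_functional_lim UU (fun j => (gP j).1).
have fc j : exists k, c / 2 <= `|f (x (n j + k)%N)|.
  (* The index where [g l] is large varies with [l], but the block is finite: if [f] were below
     [c / 2] on it, then [U]-many [g l] would be below [c] on all of it at once. *)
  apply: contrapT => Hk.
  have hk k : c / 2 > `|f (x (n j + k)%N)|.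
    by rewrite ltNge; apply/negP => ?; apply: Hk; exists k.
  have near_small m : U [set l | forall k, (k <= m)%N -> `|g l (x (n j + k)%N)| < c].
    have one k : U [set l | `|g l (x (n j + k)%N)| < c].
      have /cvgrPdist_lt/(_ (c / 2)) := gf (x (n j + k)%N).
      rewrite divr_gt0// => /(_ isT); apply: filterS => l hl.
      have := ler_normD (f (x (n j + k)%N) ) (g l (x (n j + k)%N) - f (x (n j + k)%N)).
      by rewrite addrC subrK [`|g l _ - _|]distrC; have := hk k; move: hl; rewrite /=; lra.
    elim: m => [|m IH]; first by
      apply: filterS (one 0%N) => l /= hl k; rewrite leqn0 => /eqP->.
    apply: filterS (filterI IH (one m.+1)) => l [hl hm] k.
    by rewrite leq_eqVlt => /predU1P[->//|]; rewrite ltnS; exact: hl.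
  have Uj : U [set l | (j <= l)%N] by apply: sU; exact: nbhs_infty_ge.
  have [l [/= hl jl]] := filter_ex (filterI (near_small (i (n j, j))) Uj).
  have [k [ki kc]] := (gP l).2 j jl.
  by have := hl k ki; rewrite ltNge kc.
have /cvgrPdist_lt/(_ (c / 2)) := xw f 1 f1.
rewrite divr_gt0// => /(_ isT)[m _ hm].
have [k hk] := fc m.
have := hm (n m + k)%N; rewrite /= sub0r normrN ltNge hk => /(_ _)/negP; apply=> //.
by rewrite (leq_trans (nj m))// leq_addr.
Qed.

End AM_weak_sequences.

(** * Weak compactness *)

Section AM_M_weakly_compact.
Context {R : realType} {E : banachLatticeType R} {X : completeNormedModType R}.
Hypothesis AM : AM_space E.
Variables (T : {linear E -> X}) (K : R).
Hypotheses (K0 : 0 <= K) (TK : forall x, `|T x| <= K * `|x|).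
Hypothesis (MT : M_weakly_compact T).
Implicit Types (x y z u v w : E) (f g mu nu : E -> R).

(* [Psi x] is the sum of the [mu (labs (x - t))] over a grid of levels [t]. *)
Lemma convex_potential mu M : positive_functional mu -> bounded_functional mu M ->
  0 <= M -> exists (Psi : E -> R) (B : R),
    (forall x, `|x| <= 1 -> 0 <= Psi x <= B) /\
    forall x y, `|x| <= 1 -> `|y| <= 1 ->
      mu (labs (x - y)) <= Psi x + Psi y - 2 * Psi (2^-1 *: (x + y)) + 1.
Proof.
move=> pmu muM M0; have smu := pmu.1.
(* The mesh [mu e] and the overshoot beyond [w] are each at most [1 / 4]; doubled in [half], they
   make the [1] of the conclusion. *)
have q0 : 0 < 4^-1 :> R by rewrite invr_gt0.
have [w [w0 w1 hw]] := AM_truncation AM pmu muM ler01 q0.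
have [N hN] := nat_gt (4 * mu w).
have N0 : 0 < N%:R :> R by apply: le_lt_trans hN; rewrite mulr_ge0// pmu.2.
pose e := N%:R^-1 *: w.
have e0 : 0 <= e by rewrite scale_ge0// invr_ge0 ltW.
have mue : mu e <= 4^-1.
  by rewrite (scalarZ smu) ler_pdivrMl//; lra.
pose Psi x := \sum_(j < N.+1) (mu (labs (x - j%:R *: e)) + mu (labs (x + j%:R *: e))).
have mul x : 0 <= mu (labs x) by rewrite pmu.2// labs_ge0.
have muM' x : mu (labs x) <= M * `|x|.
  by apply: (le_trans (ler_norm _)); rewrite -(norm_labs x); exact: muM.2.
exists Psi, (\sum_(j < N.+1) (2 * (M * (1 + `|j%:R *: e|)))); split.
  move=> x x1; rewrite sumr_ge0/=; last by move=> j _; rewrite addr_ge0.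
  apply: ler_sum => j _; rewrite mulr_natl mulr2n; apply: lerD.
    apply: (le_trans (muM' _)); rewrite ler_wpM2l//.
    by apply: (le_trans (ler_normB _ _)); rewrite lerD2r.
  apply: (le_trans (muM' _)); rewrite ler_wpM2l//.
  by apply: (le_trans (ler_normD _ _)); rewrite lerD2r.
move=> x y x1 y1; pose m := 2^-1 *: (x + y); pose g := 2^-1 *: (x \join y - x \meet y).
have m1 : `|m| <= 1.
  rewrite normrZ ger0_norm ?invr_ge0// ler_pdivrMl// mulr1.
  by apply: (le_trans (ler_normD _ _)); rewrite -[2](natrD _ 1 1) lerD.
have defect t : mu (crossing m g t) * 2 <=
    mu (labs (x - t)) + mu (labs (y - t)) - 2 * mu (labs (m - t)).
  have := positive_mono pmu (convexity_defect x y t).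
  have -> : (x - t) + (y - t) = 2%:R *: (m - t).
    rewrite scalerBr scalerA divff ?pnatr_eq0// scale1r scaler_nat mulr2n opprD.
    by rewrite addrACA.
  rewrite labsZ ger0_norm// !(scalarD smu) !(scalarZ smu); lra.
have cross : mu g <= \sum_(j < N.+1) (mu (crossing m g (j%:R *: e)) +
    mu (crossing m g (- (j%:R *: e)))) + (4^-1 + 4^-1).
  apply: (le_trans (positive_mono pmu (crossing_grid m g N e0))).
  rewrite (scalarD smu) (scalar_sum smu); apply: lerD.
    by apply: ler_sum => j _; rewrite (scalarD smu).
  rewrite (scalarD smu) lerD// scalerA divff ?gt_eqF// scale1r.
  exact: hw.
have half : mu (labs (x - y)) <= 2 * mu g.
  rewrite -(scalarZ smu) scalerA divff ?pnatr_eq0// scale1r.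
  exact: (positive_mono pmu (labsB_le x y)).
suff : 2 * \sum_(j < N.+1) (mu (crossing m g (j%:R *: e)) +
    mu (crossing m g (- (j%:R *: e)))) <= Psi x + Psi y - 2 * Psi m by move: half cross; lra.
rewrite /Psi !mulr_sumr -big_split/= -sumrB; apply: ler_sum => j _.
have := defect (j%:R *: e); have := defect (- (j%:R *: e)); rewrite !opprK; lra.
Qed.

(* [z] almost minimises [Psi] over a convex set [C0] carrying the ultrafilter on
   which the infimum of [Psi] is almost as large as possible; any other such near
   minimiser in [C0] is close to [z] by the convexity of [Psi]. *)
Lemma ball_image_approximation (G : set_system X) (d : R) : UltraFilter G ->
  G [set T x | x in [set x | `|x| <= 1]] -> 0 < d ->
  exists y : X, forall h (l : R), bounded_functional h 1 -> h @ G --> l ->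
    `|h y - l| <= d.
Proof.
move=> UG GB d0; have d4 : 0 < d / 4 by rewrite divr_gt0.
have [mu [M [pmu muM M0 hmu]]] := M_weakly_compact_control K0 TK MT d4.
have [Psi [B [PsiB Psic]]] := convex_potential pmu muM M0.
(* A class of convex sets, rather than the hulls themselves, so that cutting a member by a slab
   stays in the class. *)
pose D (C : set E) := [/\ C `<=` [set x | `|x| <= 1],
  forall x y, C x -> C y -> C (2^-1 *: (x + y)) &
  exists2 A, G A & forall x, `|x| <= 1 -> A (T x) -> C x].
have Dne C : D C -> C !=set0.
  move=> [_ _ [A GA hA]]; have [_ [[x x1 <-] Ax]] := filter_ex (filterI GB GA).
  by exists x; exact: hA.
have DT : D [set x | `|x| <= 1].
  split=> // [x y /= x1 y1|]; last by exists setT => //; exact: filterT.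
  rewrite normrZ ger0_norm ?invr_ge0// ler_pdivrMl// mulr1.
  by apply: (le_trans (ler_normD _ _)); rewrite -[2](natrD _ 1 1) lerD.
have infC C : D C -> has_inf [set Psi x | x in C].
  move=> DC; split; first by have [x Cx] := Dne _ DC; exists (Psi x), x.
  by exists 0 => _ [x Cx <-]; have [CB _ _] := DC; have /andP[] := PsiB _ (CB _ Cx).
pose I C := inf [set Psi x | x in C].
have supI : has_sup [set I C | C in D].
  split; first by exists (I [set x | `|x| <= 1]), [set x | `|x| <= 1].
  exists B => _ [C DC <-]; have [x Cx] := Dne _ DC; have [CB _ _] := DC.
  have /andP[_] := PsiB _ (CB _ Cx); apply: le_trans.
  by apply: ge_inf; [exact: (infC _ DC).2|exists x].
pose s := sup [set I C | C in D].
have n0 : 0 < 4^-1 :> R by rewrite invr_gt0.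
have near_inf C : D C -> exists2 z, C z & Psi z < s + 4^-1.
  move=> DC; have [_ [z Cz <-] hz] := inf_adherent n0 (infC _ DC).
  exists z => //; apply: (lt_le_trans hz); rewrite lerD2r.
  by apply: sup_upper_bound => //; exists C.
have [_ [C0 DC0 <-] hC0] := sup_adherent n0 supI.
have [C0B C0c [A0 GA0 hA0]] := DC0.
have [z C0z Psiz] := near_inf _ DC0.
exists (T z) => h l h1 hl.
have shT x y k : h (T (k *: x + y)) = k * h (T x) + h (T y).
  by rewrite linearP h1.1.
(* [z] was fixed before [h]. The slab around [l] is still in [D], so it contains a near minimiser
   [z'] to compare with [z]. *)
pose C := [set x | C0 x /\ `|h (T x) - l| <= d / 2].
have DC : D C.
  split.
  - by move=> x [/C0B].
  - move=> x y [C0x hx] [C0y hy]; split; first exact: C0c.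
    have -> : h (T (2^-1 *: (x + y))) - l = 2^-1 * ((h (T x) - l) + (h (T y) - l)).
      by rewrite linearZ linearD/= (scalarZ h1.1) (scalarD h1.1); lra.
    rewrite normrM ger0_norm ?invr_ge0// ler_pdivrMl//.
    apply: (le_trans (ler_normD _ _)); move: hx hy; rewrite /=; lra.
  - exists (A0 `&` [set y | `|h y - l| <= d / 2]).
      apply: filterI => //; have /cvgrPdist_le/(_ (d / 2)) := hl.
      by rewrite divr_gt0// => /(_ isT); apply: filterS => y; rewrite distrC.
    by move=> x x1 [A0x hx]; split=> //; exact: hA0.
have [z' [C0z' hz'] Psiz'] := near_inf _ DC.
have z1 := C0B _ C0z; have z'1 := C0B _ C0z'.
have mid : s - 4^-1 < Psi (2^-1 *: (z + z')).
  apply: (lt_le_trans hC0); apply: ge_inf; first exact: (infC _ DC0).2.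
  by exists (2^-1 *: (z + z')) => //; exact: C0c.
(* The errors are [1 / 4] for each of [z] and [z'], [2 / 4] for the midpoint, and [1] from [Psic];
   half of [z - z'] then meets both conditions of [hmu]. *)
have muz : mu (labs (z - z')) <= 2.
  by have := Psic z z' z1 z'1; move: Psiz Psiz' mid; lra.
have Tz : `|T z - T z'| <= d / 2.
  have := hmu (2^-1 *: (z - z')).
  rewrite normrZ ger0_norm ?invr_ge0// labsZ ger0_norm ?invr_ge0// (scalarZ pmu.1).
  rewrite linearZ normrZ ger0_norm ?invr_ge0// linearB/= => H.
  have : 2^-1 * `|T z - T z'| <= d / 4; last by lra.
  apply: H; last by lra.
  have := ler_normB z z'; move: z1 z'1; rewrite /=; lra.
have := h1.2 (T z - T z'); rewrite mul1r (scalarB h1.1) => hzz.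
have := ler_normD (h (T z) - h (T z')) (h (T z') - l).
rewrite addrA subrK; move: hz' hzz Tz; lra.
Qed.

(** The approximants for [d = n.+1%:R^-1] are Cauchy, because a norming functional compares two of
    them through the same ultrafilter limit. Their norm limit is the weak limit. *)
Lemma M_weakly_compact_weakly_compact : weakly_compact T.
Proof.
apply/relatively_weakly_compactP => G UG GB.
have flim h M : bounded_functional h M -> exists l : R, h @ G --> l.
  move=> [sh hM]; apply: (@ultra_cvg R X G h (`|M| * K) UG).
  apply: filterS GB => _ [x /= x1 <-]; apply: (le_trans (hM _)).
  apply: (@le_trans _ _ (`|M| * `|T x|)); first by rewrite ler_wpM2r// ler_norm.
  rewrite ler_wpM2l//; apply: (le_trans (TK x)).
  by rewrite -[leRHS]mulr1 ler_wpM2l.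
have p0 n : 0 < n.+1%:R^-1 :> R by rewrite invr_gt0.
have [y yP] := boolp.choice (fun n => ball_image_approximation UG GB (p0 n)).
have yc n m : `|y n - y m| <= n.+1%:R^-1 + m.+1%:R^-1.
  have [h h1 hy] := norming_functional (y n - y m); rewrite -hy (scalarB h1.1).
  have [l hl] := flim h 1 h1.
  apply: (le_trans (ler_norm _)).
  have := ler_normB (h (y n) - l) (h (y m) - l); rewrite opprB addrA subrK.
  by move=> /le_trans; apply; apply: lerD; exact: yP.
have inv0 : n.+1%:R^-1 @[n --> \oo] --> (0 : R) by exact: cvg_harmonic.
have cy : cvgn y.
  apply/cauchy_cvgP/cauchy_exP => e e0.
  have e2 : 0 < e / 2 by rewrite divr_gt0.
  have /cvgrPdist_lt/(_ _ e2)[N _ hN] := inv0.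
  exists (y N), N => // m /= Nm; rewrite -ball_normE /=.
  apply: (le_lt_trans (yc N m)).
  have h k : (N <= k)%N -> k.+1%:R^-1 < e / 2.
    by move=> /hN; rewrite /= sub0r normrN; exact: le_lt_trans (ler_norm _).
  by rewrite [ltRHS]splitr ltrD ?h.
exists (lim (y @ \oo)) => f M fM.
have [l hl] := flim f M fM.
suff -> : f (lim (y @ \oo)) = l by [].
have fy : f (y n) @[n --> \oo] --> f (lim (y @ \oo)).
  by apply: (cvg_comp y f cy); exact: (bounded_functional_continuous fM).
suff fl : f (y n) @[n --> \oo] --> l by rewrite -(cvg_lim _ fy)// (cvg_lim _ fl).
(* The approximation is stated for functionals of bound [1], hence the rescaling. *)
pose c : R := `|M| + 1; have c0 : 0 < c by rewrite ltr_wpDl.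
have g1 : bounded_functional (fun x : X => c^-1 * f x) 1.
  split=> [k x x'|x]; first by rewrite fM.1; ring.
  rewrite normrM gtr0_norm ?invr_gt0// ler_pdivrMl// mul1r.
  apply: (le_trans (fM.2 x)); rewrite ler_wpM2r// /c.
  by rewrite (le_trans (ler_norm M))// lerDl.
have gl : c^-1 * f x @[x --> G] --> c^-1 * l by exact: cvgMr.
have cinv0 : c * n.+1%:R^-1 @[n --> \oo] --> (0 : R).
  by rewrite -(mulr0 c); exact: cvgMr.
apply/cvgrPdist_le => e e0; move/cvgrPdist_le/(_ e e0) : cinv0; apply: filterS => n.
rewrite sub0r normrN => /(le_trans (ler_norm _)); apply: le_trans.
have := yP n _ _ g1 gl.
by rewrite -mulrBr normrM gtr0_norm ?invr_gt0// ler_pdivrMl// distrC.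
Qed.

End AM_M_weakly_compact.

Lemma filter_forall_ltn (I : Type) (F : set_system I) (A : nat -> set I) m :
  Filter F -> (forall k, (k < m)%N -> F (A k)) ->
  F [set i | forall k, (k < m)%N -> A k i].
Proof.
move=> FF; elim: m => [|m IH] h; first by apply: filterS filterT => i _ k.
have hm := IH (fun k km => h k (ltnW km)).
apply: filterS (filterI hm (h m (ltnSn m))) => i [Hi Ai] k.
by rewrite ltnS leq_eqVlt => /predU1P[->//|]; exact: Hi.
Qed.

(** * From weak compactness to M-weak compactness *)

Section weakly_compact_operators.
Context {R : realType}.

(* The easy half of James's criterion. *)
Lemma weakly_compact_no_separation (X : normedModType R) (A : set X)
    (y : nat -> X) (h : nat -> X -> R) (t : R) : 0 < t ->
  relatively_weakly_compact A -> (forall m, A (y m)) ->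
  (forall k, bounded_functional (h k) 1) ->
  (forall k m, (k < m)%N -> 2 * t <= h k (y m)) ->
  (forall k m, (m <= k)%N -> h k (y m) <= t) -> False.
Proof.
move=> t0 /relatively_weakly_compactP cA Ay h1 hhi hlo.
have [U UU sU] := ultra_infty.
have [|p hp] := cA _ (ultra_fmap y UU).
  by apply: (@filterS _ U _ setT) => [m _|]; [exact: Ay|exact: filterT].
(* Both iterated limits of [h k (y m)] along [U] are [g p], but one is at most [t] and the other at
   least [2 * t]. *)
have [g g1 hg] := bounded_functional_lim UU h1.
have cvg_is (u : nat -> R) (l : R) : u @ U --> l -> cvg (u @ U).
  by move=> ul; apply/cvg_ex; exists l.
have gy m : g (y m) <= t.
  rewrite -(cvg_lim _ (hg (y m)))//; apply: limr_le; first exact: cvg_is (hg _).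
  by apply: sU; exists m => // k /= mk; exact: hlo.
have gp : g p <= t.
  have gyp : g (y m) @[m --> U] --> g p by exact: hp g1.
  rewrite -(cvg_lim _ gyp)//; apply: limr_le; first exact: cvg_is gyp.
  by apply: nearW => m; exact: gy.
have hpk k : 2 * t <= h k p.
  have hyp : h k (y m) @[m --> U] --> h k p by exact: hp (h1 k).
  rewrite -(cvg_lim _ hyp)//; apply: limr_ge; first exact: cvg_is hyp.
  by apply: sU; exists k.+1 => // m /= km; exact: hhi.
have : 2 * t <= g p.
  rewrite -(cvg_lim _ (hg p))//; apply: limr_ge; first exact: cvg_is (hg _).
  by apply: nearW => k; exact: hpk.
lra.
Qed.

(** Attaching the signs of [g (x n)] to the [x n] keeps the partial sums bounded by
    [AM_disjoint_sum], so the series of the moduli of the [g (x n)] converges. *)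
Lemma AM_disjoint_weakly_null (E : banachLatticeType R) (x : nat -> E) (C : R)
    (g : E -> R) M : AM_space E ->
  (forall n, `|x n| <= C) ->
  (forall n m, n != m -> Order.meet (labs (x n)) (labs (x m)) = 0) ->
  bounded_functional g M -> g (x n) @[n --> \oo] --> (0 : R).
Proof.
move=> AM xC dx [sg gM].
have C0 : 0 <= C by exact: le_trans (xC 0%N).
pose s n : R := Num.sg (g (x n)).
have s1 n : `|s n| <= 1 by rewrite /s normr_sg; case: (_ != _).
pose z n := s n *: x n.
have zC n : `|z n| <= C.
  by rewrite normrZ (le_trans _ (xC n))// ler_piMl.
have dz n m : n != m -> Order.meet (labs (z n)) (labs (z m)) = 0.
  move=> nm; apply: (meet_disj_le (labs_ge0 _) (labs_ge0 _) _ _ (dx n m nm));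
  by rewrite labsZ -[leRHS]scale1r le_scalel// labs_ge0.
have cs : cvgn (series (fun n => `|g (x n)|)).
  apply: nondecreasing_is_cvgn.
    apply/nondecreasing_seqP => n; rewrite /series/= big_nat_recr//= lerDl//.
  exists (`|M| * C) => _ [n _ <-].
  have -> : series (fun n => `|g (x n)|) n = g (\sum_(i < n) z i).
    rewrite (scalar_sum sg) /series/= big_mkord; apply: eq_bigr => i _.
    by rewrite (scalarZ sg) /s -normrEsg.
  apply: (le_trans (ler_norm _)); apply: (le_trans (gM _)).
  apply: (@le_trans _ _ (`|M| * `|\sum_(i < n) z i|)); first by rewrite ler_wpM2r// ler_norm.
  by rewrite ler_wpM2l// AM_disjoint_sum.
by apply/norm_cvg0P; exact: cvg_series_cvg_0 cs.
Qed.

(* The subsequence [n] is chosen so that [h (n k) (T (v (n j)))] is negligible for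
   [j != k]; this is possible because [v] is weakly null and [h] may be compared
   with its limit [f] along an ultrafilter. *)
Lemma weakly_compact_M_weakly_compact (E : banachLatticeType R)
    (X : completeNormedModType R) (T : {linear E -> X}) (K : R) :
  AM_space E -> 0 <= K -> (forall x, `|T x| <= K * `|x|) ->
  weakly_compact T -> M_weakly_compact T.
Proof.
move=> AM K0 TK wT x /bounded_funP[C' xC'] dx.
pose C := `|C'| + 1; have C0 : 0 < C by rewrite ltr_wpDl.
have xC n : `|x n| <= C.
  by apply: (le_trans (xC' n)); apply: (le_trans (ler_norm _)); rewrite lerDl.
apply/cvgrPdist_le => e e0; apply: contrapT => H.
have hbig N : exists n, (N <= n)%N /\ e < `|T (x n)|.
  apply: contrapT => h; apply: H; exists N => // n /= Nn.
  rewrite sub0r normrN ger0_norm// leNgt; apply/negP => en; apply: h.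
  by exists n.
have [psi psiP] := boolp.choice hbig.
pose v n := x (psi n).
have hnorm n : exists h : X -> R, bounded_functional h 1 /\ h (T (v n)) = `|T (v n)|.
  by have [h] := norming_functional (T (v n)); exists h.
have [h hP] := boolp.choice hnorm.
have h1 n := (hP n).1.
have hT n : bounded_functional (fun y => h n (T y)) K.
  split=> [k y z|y]; first by rewrite linearP (h1 n).1.
  by rewrite (le_trans ((h1 n).2 _))// mul1r.
have psi_inf : forall N, \forall n \near \oo, (N <= psi n)%N.
  by move=> N; exists N => // n /= Nn; rewrite (leq_trans Nn)// (psiP n).1.
have vnull (g : E -> R) M : bounded_functional g M -> g (v n) @[n --> \oo] --> (0 : R).
  move=> gM; apply/cvgrPdist_lt => d d0.
  have /cvgrPdist_lt/(_ d d0)[N _ hN] := AM_disjoint_weakly_null AM xC dx gM.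
  by apply: filterS (psi_inf N) => n; exact: hN.
have [U UU sU] := ultra_infty.
have [f f1 hf] := bounded_functional_lim UU h1.
have fT : bounded_functional (fun y => f (T y)) K.
  split=> [k y z|y]; first by rewrite linearP f1.1.
  by rewrite (le_trans (f1.2 _))// mul1r.
pose d j : R := e / 16 * 2 ^- j.
have p2 j : 0 < 2 ^- j :> R by rewrite invr_gt0 exprn_gt0.
have d0 j : 0 < d j by rewrite mulr_gt0// divr_gt0.
(* The premise keeps [f] strictly below [d j] at the vectors already chosen, hence so are [U]-many
   [h n]. Lists violating it get a default index. *)
have step s : exists n, (forall j, (j < size s)%N -> `|f (T (v (nth 0%N s j)))| < d j) ->
    [/\ `|f (T (v n))| < d (size s),
        forall j, (j < size s)%N -> `|h n (T (v (nth 0%N s j)))| < d j &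
        forall j, (j < size s)%N -> `|h (nth 0%N s j) (T (v n))| < d (size s)].
  have [gs|ngs] := pselect (forall j, (j < size s)%N ->
      `|f (T (v (nth 0%N s j)))| < d j); last first.
    by exists 0%N => gs.
  have small (g : E -> R) M : bounded_functional g M -> U [set n | `|g (v n)| < d (size s)].
    move=> gM; apply: sU; have /cvgrPdist_lt/(_ _ (d0 (size s))) := vnull g M gM.
    by apply: filterS => n; rewrite sub0r normrN.
  have U1 := small _ _ fT.
  have U2 : U [set n | forall j, (j < size s)%N -> `|h n (T (v (nth 0%N s j)))| < d j].
    apply: filter_forall_ltn => j js.
    have hfn : `|h n (T (v (nth 0%N s j)))| @[n --> U] --> `|f (T (v (nth 0%N s j)))|.
      by apply: cvg_norm; exact: hf.
    move/cvgrPdist_lt : hfn.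
    have gj := gs j js; move=> /(_ (d j - `|f (T (v (nth 0%N s j)))|)).
    rewrite subr_gt0 => /(_ gj); apply: filterS => n /=.
    rewrite distrC => /(le_lt_trans (ler_norm _)); lra.
  have U3 : U [set n | forall j, (j < size s)%N -> `|h (nth 0%N s j) (T (v n))| < d (size s)].
    by apply: filter_forall_ltn => j js; exact: small (hT _).
  by have [n [[n1 n2] n3]] := filter_ex (filterI (filterI U1 U2) U3); exists n.
have [phi phiP] := boolp.choice step.
pose S := fix S k : seq nat := if k is k'.+1 then rcons (S k') (phi (S k')) else [::].
pose n k := phi (S k).
have sS k : size (S k) = k by elim: k => //= k IH; rewrite size_rcons IH.
have nS k j : (j < k)%N -> nth 0%N (S k) j = n j.
  elim: k => // k IH; rewrite ltnS leq_eqVlt /= nth_rcons sS => /predU1P[->|jk].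
    by rewrite ltnn eqxx.
  by rewrite jk IH.
have fn k : `|f (T (v (n k)))| < d k.
  have [m] := ubnP k; elim: m k => // m IH k km.
  have := phiP (S k); rewrite sS => -[|//].
  by move=> j jk; rewrite nS// IH// (leq_trans jk).
have hn k : [/\ forall j, (j < k)%N -> `|h (n k) (T (v (n j)))| < d j &
    forall j, (j < k)%N -> `|h (n j) (T (v (n k)))| < d k].
  have := phiP (S k); rewrite sS => -[|_ a b].
    by move=> j jk; rewrite nS.
  by split=> j jk; [have := a j jk|have := b j jk]; rewrite nS.
have hjk k j : j != k -> `|h (n k) (T (v (n j)))| < d j.
  by case: ltngtP => // jk _; [exact: (hn k).1|exact: (hn j).2].
have hkk k : e < h (n k) (T (v (n k))) by rewrite (hP _).2 (psiP _).2.
have de j : d j <= e.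
  rewrite /d -mulrA ger_pMr// -[leRHS](mulr1 1); have : 2 ^- j <= 1 :> R.
    by rewrite invf_le1 ?exprn_gt0// exprn_ege1// ler1n.
  have := p2 j; lra.
(* [psi] may repeat values, but [h (n k)] exceeds [e] at its own vector and is below [d j <= e] at
   the others. *)
have ninj k j : k != j -> psi (n k) != psi (n j).
  move=> kj; apply/eqP => pkj; have := hkk k.
  have -> : v (n k) = v (n j) by rewrite /v pkj.
  move=> ek.
  have := le_trans (ltW (hjk k j _)) (de j).
  rewrite eq_sym kj => /(_ isT) /(le_trans (ler_norm _)).
  by rewrite leNgt ek.
pose y m := \sum_(j < m) v (n j).
have yC m : `|y m| <= C.
  apply: (AM_disjoint_sum (x := fun j => v (n j))) => //; first exact: ltW.
  - by move=> j; exact: xC.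
  - by move=> i j ij; apply: dx; exact: ninj.
have hy k m : h (n k) (T (y m)) = \sum_(j < m) h (n k) (T (v (n j))).
  by rewrite linear_sum (scalar_sum (h1 _).1).
have dsum m : \sum_(j < m) d j <= e / 8.
  suff -> : \sum_(j < m) d j = e / 8 * (1 - 2 ^- m) by have := p2 m; nra.
  elim: m => [|m IH]; first by rewrite big_ord0 expr0 invr1 subrr mulr0.
  by rewrite big_ord_recr/= IH /d !exprS !invfM; lra.
have sumle m k : (forall j, (j < m)%N -> j != k) ->
    `|\sum_(j < m) h (n k) (T (v (n j)))| <= e / 8.
  move=> jk; apply: (le_trans (ler_norm_sum _ _ _)); apply: le_trans (dsum m).
  by apply: ler_sum => j _; apply/ltW/hjk/jk.
pose A := [set C *: z + 0 | z in [set T z | z in [set z : E | `|z| <= 1]]].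
have cA : relatively_weakly_compact A.
  by apply: relatively_weakly_compact_affine => //; rewrite gt_eqF.
have Ay m : A (T (y m)).
  exists (C^-1 *: T (y m)).
    exists (C^-1 *: y m); last by rewrite linearZ.
    by rewrite /= normrZ gtr0_norm ?invr_gt0// ler_pdivrMl// mulr1.
  by rewrite scalerA divff ?gt_eqF// scale1r addr0.
(* The diagonal term exceeds [e] and the others sum to at most [e / 8]: above [2 * (e / 4)] when it
   occurs, below [e / 4] when it does not. *)
have e4 : 0 < e / 4 by rewrite divr_gt0.
apply: (weakly_compact_no_separation e4 cA Ay (fun k => h1 (n k))) => k m.
  move=> km; rewrite hy (bigD1 (Ordinal km))//=.
  have : `|\sum_(j < m | j != Ordinal km) h (n k) (T (v (n j)))| <= e / 8.
    apply: (le_trans (ler_norm_sum _ _ _)); apply: le_trans (dsum m).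
    rewrite [leRHS](bigD1 (Ordinal km))//= -[leLHS]add0r lerD ?(ltW (d0 _))//.
    by apply: ler_sum => j jk; apply/ltW/hjk.
  rewrite ler_norml => /andP[+ _]; have := hkk k; lra.
move=> mk; rewrite hy; have := sumle m k => /(_ _)/(le_trans (ler_norm _)) h8.
apply: (le_trans (h8 _)); last by lra.
by move=> j jm; rewrite ltn_eqF// (leq_trans jm).
Qed.

End weakly_compact_operators.

(** * un, uaw and wun convergence in AM-spaces *)

Section AM_functionals.
Context {R : realType} {E : banachLatticeType R}.
Hypothesis AM : AM_space E.

Lemma tails_filter (I : Type) (le : I -> I -> Prop) : directed le -> Filter (tails le).
Proof.
move=> [[i0] lexx le_trans le_ub]; apply: filter_from_filter; first by exists i0.
move=> i j _ _; have [k [ik jk]] := le_ub i j.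
by exists k => // l /= kl; split; [exact: le_trans ik kl|exact: le_trans jk kl].
Qed.

Lemma AM_bounded_un_dual (f : E -> R) M : bounded_functional f M -> un_dual f.
Proof.
move=> fM; split=> [|I le x dir /bounded_funP[C xC] x0]; first exact: fM.1.
have FF := tails_filter dir.
apply: (AM_functional_cvg0 AM FF fM xC) => nu pnu nuM u u0.
apply/norm_cvg0P.
have lim0 : M * `|Order.meet (labs (x i - 0)) u| @[i --> tails le] --> (0 : R).
  by rewrite -(mulr0 M); apply: cvgMr; exact: x0.
apply: (@squeeze_cvgr _ _ _ _ (cst 0) (fun i => M * `|Order.meet (labs (x i - 0)) u|)).
- by apply: nearW => i; rewrite normr_ge0/= subr0; exact: nuM.2.
- exact: cvg_cst.
- exact: lim0.
Qed.

(** Norm null sequences are un-null, and an unbounded [f] would be constantly [1] along one.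
    Together with [AM_bounded_un_dual] this identifies the wun-topology of an AM-space with its weak
    topology. *)
Lemma un_dual_bounded (f : E -> R) : un_dual f -> exists M, bounded_functional f M.
Proof.
move=> [sf fun0]; apply: contrapT => H.
have h (n : nat) : exists z : E, `|z| <= n.+1%:R^-1 /\ f z = 1.
  apply: contrapT => h; apply: H; exists n.+1%:R; split=> // x.
  rewrite leNgt; apply/negP => xf; apply: h; exists ((f x)^-1 *: x).
  have fx : f x != 0 by rewrite -normr_gt0 (le_lt_trans _ xf)// mulr_ge0.
  split; last by rewrite (scalarZ sf) mulVf.
  rewrite normrZ normfV ler_pdivrMl ?normr_gt0// mulrC ler_pdivlMl//.
  exact: ltW.
have [z zP] := boolp.choice h.
have inv0 : n.+1%:R^-1 @[n --> \oo] --> (0 : R) by exact: cvg_harmonic.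
pose leN (i j : nat) : Prop := (i <= j)%N.
have dir : directed leN.
  split; [exact: inhabits 0%N|exact: leqnn|by move=> i j k; exact: leq_trans|].
  by move=> i j; exists (maxn i j); rewrite /leN leq_maxl leq_maxr.
have zb : bounded_fun z.
  apply/bounded_funP; exists 1 => n; apply: (le_trans (zP n).1).
  by rewrite invf_le1// ler1n.
have z0 : un_cvg (tails leN) z 0.
  move=> u u0.
  suff : `|Order.meet (labs (z n - 0)) u| @[n --> \oo] --> (0 : R) by [].
  apply: (@squeeze_cvgr _ _ _ _ (cst 0) (fun n => n.+1%:R^-1)).
  - apply: nearW => n; rewrite normr_ge0/= (le_trans _ (zP n).1)// subr0.
    apply: norm_le; rewrite labs_pos ?meet_ge0 ?labs_ge0//; exact: leIl.
  - exact: cvg_cst.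
  - exact: inv0.
have fz : f (z n) @[n --> \oo] --> (0 : R) := fun0 nat leN z dir zb z0.
move/cvgrPdist_lt/(_ 1 ltr01) : fz => [n _ /(_ n (leqnn n))].
by rewrite /= (zP n).2 sub0r normrN1 ltxx.
Qed.

Lemma AM_weak_disjoint (x : nat -> E) : bounded_fun x ->
  (forall n m, n != m -> Order.meet (labs (x n)) (labs (x m)) = 0) ->
  x @ \oo --> ((0 : E) : weak E).
Proof.
move=> /bounded_funP[C xC] dx; apply/weak_cvgP => f M fM.
by rewrite (scalar0 fM.1); exact: AM_disjoint_weakly_null xC dx fM.
Qed.

Lemma AM_wun_disjoint (x : nat -> E) : bounded_fun x ->
  (forall n m, n != m -> Order.meet (labs (x n)) (labs (x m)) = 0) ->
  x @ \oo --> ((0 : E) : wun E).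
Proof.
move=> bx dx; apply/functional_cvgP => f /un_dual_bounded[M fM].
by move/weak_cvgP : (AM_weak_disjoint bx dx); apply; exact: fM.
Qed.

Lemma AM_uaw_disjoint (x : nat -> E) : bounded_fun x ->
  (forall n m, n != m -> Order.meet (labs (x n)) (labs (x m)) = 0) ->
  uaw_cvg \oo x 0.
Proof.
move=> /bounded_funP[C xC] dx u u0; apply: AM_weak_disjoint.
  apply/bounded_funP; exists C => n; apply: le_trans (xC n); rewrite subr0.
  by apply: norm_le; rewrite labs_pos ?meet_ge0 ?labs_ge0// leIl.
move=> n m nm; rewrite !subr0.
have p k : 0 <= Order.meet (labs (x k)) u by rewrite meet_ge0 ?labs_ge0.
rewrite (labs_pos (p n)) (labs_pos (p m)).
exact: (meet_disj_le (p n) (p m) (leIl _ _) (leIl _ _) (dx n m nm)).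
Qed.

Lemma AM_uaw_weak (x : nat -> E) : bounded_fun x -> uaw_cvg \oo x 0 ->
  x @ \oo --> ((0 : E) : weak E).
Proof.
move=> /bounded_funP[C xC] x0; apply/weak_cvgP => f M fM; rewrite (scalar0 fM.1).
apply: (AM_functional_cvg0 AM _ fM xC) => nu pnu nuM u u0.
have /weak_cvgP/(_ nu M nuM) := x0 u u0.
by rewrite (scalar0 pnu.1); under eq_fun do rewrite subr0.
Qed.

Lemma AM_wun_weak (x : nat -> E) :
  x @ \oo --> ((0 : E) : wun E) -> x @ \oo --> ((0 : E) : weak E).
Proof.
move=> /functional_cvgP x0; apply/weak_cvgP => f M fM.
by apply: x0; exact: AM_bounded_un_dual fM.
Qed.

End AM_functionals.

(** * Implications between the operator classes *)

Section AM_operators.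
Context {R : realType} {E : banachLatticeType R} {X : completeNormedModType R}.
Hypothesis AM : AM_space E.
Variables (T : {linear E -> X}) (K : R).
Hypotheses (K0 : 0 <= K) (TK : forall x, `|T x| <= K * `|x|).

Lemma weakly_null_bounded (V : normedModType R) (x : nat -> V) :
  x @ \oo --> ((0 : V) : weak V) -> bounded_fun x.
Proof.
move=> /weak_cvgP x0; apply/bounded_funP; apply: weakly_bounded => f M fM.
have fx := x0 f M fM.
have /cvg_seq_bounded : cvgn (fun n => f (x n)) by apply/cvg_ex; exists (f 0).
by move=> /(@bounded_funP R R).
Qed.

Lemma AM_M_weakly_compact_Dunford_Pettis : M_weakly_compact T -> Dunford_Pettis T.
Proof.
move=> MT x x0; have /bounded_funP[C' xC'] := weakly_null_bounded x0.
pose C := `|C'| + 1; have C0 : 0 < C by rewrite ltr_wpDl.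
have xC n : `|x n| <= C.
  by apply: (le_trans (xC' n)); apply: (le_trans (ler_norm _)); rewrite lerDl.
have {}x0 f M : bounded_functional f M -> f (x n) @[n --> \oo] --> (0 : R).
  by move=> fM; move/weak_cvgP : x0 => /(_ f M fM); rewrite (scalar0 fM.1).
apply/cvgrPdist_le => e e0.
(* The level is [e / C] because the control is applied to [x n] divided by [C]. *)
have [mu [M [pmu muM M0 hmu]]] := M_weakly_compact_control K0 TK MT (divr_gt0 e0 C0).
have := AM_weakly_null_labs AM xC x0 pmu muM M0.
move=> /cvgrPdist_le/(_ C C0); apply: filterS => n.
rewrite !sub0r !normrN normr_id => /(le_trans (ler_norm _)) hn.
have := hmu (C^-1 *: x n).
rewrite normrZ labsZ gtr0_norm ?invr_gt0// !ler_pdivrMl// mulr1 (scalarZ pmu.1).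
rewrite ler_pdivrMl// mulr1 => /(_ (xC n) hn).
by rewrite linearZ normrZ gtr0_norm ?invr_gt0// ler_pdivrMl// mulrC divfK ?gt_eqF.
Qed.

Lemma weakly_compact_bounded (A : set E) (C : R) : weakly_compact T ->
  (forall x, A x -> `|x| <= C) -> relatively_weakly_compact [set T x | x in A].
Proof.
move=> wT AC; pose D := `|C| + 1; have D0 : 0 < D by rewrite ltr_wpDl.
have := relatively_weakly_compact_affine (k := D) 0 _ wT.
rewrite gt_eqF// => /(_ isT); apply: precompact_subset => _ [x Ax <-].
exists (D^-1 *: T x); last by rewrite scalerA divff ?gt_eqF// scale1r addr0.
exists (D^-1 *: x); last by rewrite linearZ.
rewrite /= normrZ gtr0_norm ?invr_gt0// ler_pdivrMl// mulr1.
by apply: (le_trans (AC x Ax)); apply: (le_trans (ler_norm _)); rewrite lerDl.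
Qed.

(** Property (b) puts the ball between some [- u] and [u], and this interval is the image of the one
    from [0] to [u] under [z |-> 2 *: z - u]. *)
Lemma property_b_order_weakly_compact : property_b E -> order_weakly_compact T ->
  weakly_compact T.
Proof.
move=> Eb oT; have [a [b hab]] := Eb _ (AM_ball_b_order_bounded AM).
pose u := labs a + labs b.
have u0 : 0 <= u by rewrite le_add0 ?labs_ge0.
have := relatively_weakly_compact_affine (k := 2) (- T u) _ (oT u u0).
rewrite pnatr_eq0 => /(_ isT); apply: precompact_subset => _ [x x1 <-].
have /andP[ax xb] := hab x x1.
have /andP[xu Nxu] : (x <= u) && (- x <= u) by rewrite -labs_le labs_itv_le.
exists (T (2^-1 *: (x + u))); last first.
  by rewrite linearZ linearD/= scalerA divff ?pnatr_eq0// scale1r addrK.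
exists (2^-1 *: (x + u)) => //=; rewrite scale_ge0 ?invr_ge0//=; last first.
  by rewrite addrC -le_subr sub0r.
rewrite -[leRHS](midpointD u) subrr scaler0 addr0.
by rewrite le_scale ?invr_ge0// le_add2r.
Qed.

End AM_operators.

Theorem theorem3p11 (R : realType) (E : banachLatticeType R)
    (X : completeNormedModType R) (T : {linear E -> X})
    (E_AM : AM_space E) (T_continuous : continuous T) :
  [<-> M_weakly_compact T;
       weakly_compact T;
       Dunford_Pettis T;
       wun_Dunford_Pettis T;
       uaw_Dunford_Pettis T;
       b_weakly_compact T]
  /\ (property_b E ->
      [<-> M_weakly_compact T;
           weakly_compact T;
           Dunford_Pettis T;
           wun_Dunford_Pettis T;
           uaw_Dunford_Pettis T;
           b_weakly_compact T;
           order_weakly_compact T]).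
Proof.
have [K K0 TK] : exists2 K : R, 0 <= K & forall x, `|T x| <= K * `|x|.
  have : bounded_near T (nbhs (0 : E)).
    by apply: continuous_linear_bounded; exact: T_continuous.
  move=> /linear_boundedP/pinfty_ex_gt0[K K0 TK]; exists K => //; exact: ltW.
have h12 : M_weakly_compact T -> weakly_compact T.
  exact: M_weakly_compact_weakly_compact K0 TK.
have h21 : weakly_compact T -> M_weakly_compact T.
  exact: weakly_compact_M_weakly_compact K0 TK.
have h13 : M_weakly_compact T -> Dunford_Pettis T.
  exact: AM_M_weakly_compact_Dunford_Pettis K0 TK.
have h34 : Dunford_Pettis T -> wun_Dunford_Pettis T.
  by move=> DT x _ /(AM_wun_weak E_AM); exact: DT.
have h41 : wun_Dunford_Pettis T -> M_weakly_compact T.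
  by move=> wT x bx dx; apply: wT => //; exact: AM_wun_disjoint.
have h35 : Dunford_Pettis T -> uaw_Dunford_Pettis T.
  by move=> DT x bx /(AM_uaw_weak E_AM bx); exact: DT.
have h51 : uaw_Dunford_Pettis T -> M_weakly_compact T.
  by move=> uT x bx dx; apply: uT => //; exact: AM_uaw_disjoint.
have h26 : weakly_compact T -> b_weakly_compact T.
  move=> wT A /b_order_bounded_norm_bounded[C AC].
  exact: weakly_compact_bounded wT AC.
have h62 : b_weakly_compact T -> weakly_compact T.
  by move=> bT; apply: bT; exact: AM_ball_b_order_bounded.
have h27 : weakly_compact T -> order_weakly_compact T.
  move=> wT x x0; apply: (weakly_compact_bounded (C := `|x|) wT) => y /= /andP[y0 yx].
  exact: norm_le0.
have h72 : property_b E -> order_weakly_compact T -> weakly_compact T.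
  exact: property_b_order_weakly_compact.
split=> [|Eb]; tfae; tauto.
Qed.
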